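(* Let $G$ be a finitely generated group with generating set $S = \{g_1,\dots,g_k\}$. Then $$\mathrm{girth}(G,S) \geq \frac{1}{k-1-\beta_1^{(2)}(G)},$$ where the right-hand side is understood as $\infty$ if $\beta_1^{(2)}(G) = k-1$.
   Context: $\mathrm{girth}(G,S)$ denotes the length of the shortest cycle in the Cayley graph of $G$ with respect to $S$, i.e. the length of the shortest relation in terms of the generators: the minimum of the word lengths $\ell(w)$ over all non-trivial reduced words $w$ in the free group $\mathbb{F}_k$ on $k$ letters with $w(g_1,\dots,g_k)=e$ in $G$, and $\infty$ if there is no such $w$. First $\ell^2$-Betti number. For a discrete group $G$, let $\ell^2 G$ be the Hilbert space with orthonormal basis $\{\delta_g : g \in G\}$, with left- and right-regular representations $\lambda(g)\delta_h = \delta_{gh}$ and $\rho(g)\delta_h = \delta_{hg^{-1}}$. The group von Neumann algebra is $LG = \{T \in B(\ell^2 G) : \rho(g)T = T\rho(g)\ \forall g \in G\}$; it contains $\lambda(\mathbb{C}G)$, and it carries the faithful trace $\tau(a) = \langle a\delta_e,\delta_e\rangle$. Let $\dim_{LG}$, with values in $[0,\infty]$, be Lück's dimension function on (right) $LG$-modules: for a finitely generated projective module $P \cong q\,(LG)^n$ with $q=q^*=q^2 \in M_n(LG)$ one puts $\dim_{LG} P = \sum_{i=1}^n \tau(q_{ii})$, and for an arbitrary module $M$, $\dim_{LG} M$ is the supremum of $\dim_{LG} P$ over finitely generated projective submodules $P \subseteq M$. Then $$\beta_1^{(2)}(G) := \dim_{LG} H^1(G, LG),$$ where $H^1(G,LG)$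 is algebraic group cohomology with coefficients in the left $\mathbb{Z}G$-module $LG$ (acting by left multiplication via $\lambda$), with the right $LG$-module structure induced by right multiplication on $LG$. If a non-trivial group $G$ is generated by $k$ elements, then $\beta_1^{(2)}(G) \leq k-1$.
   Formalization: When k = 1 the group G is additionally assumed infinite: for a finite cyclic group with one generator, the first ℓ²-Betti number is 0 = k−1, so the right-hand side is ∞ while the girth is the finite order of G, and the claim fails. *)

(* Defs.v *)
From HB Require Import structures.
From mathcomp Require Import all_boot all_order all_algebra.
From mathcomp Require Import generic_quotient ring_quotient.
From mathcomp Require Import all_classical all_reals.
From mathcomp Require Import ereal esum numfun.
From mathcomp Require Import complex.
From mathcomp Require Import lra.

Set Implicit Arguments.
Unset Strict Implicit.
Unset Printing Implicit Defensive.

Import Order.TTheory GRing.Theory Num.Theory.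
Import Normc.

Local Open Scope classical_set_scope.
Local Open Scope ring_scope.
Local Open Scope complex_scope.
Local Open Scope quotient_scope.

Section SquareSummable.
Context (R : realType) (G : choiceType).
Implicit Types x y : G -> R[i].

Definition sqsum x : \bar R := \esum_(g in [set: G]) (normc (x g) ^+ 2)%:E.

Definition square_summable : {pred G -> R[i]} :=
  fun x => `[< (sqsum x < +oo)%E >].

Lemma sqsum_ge0 x : (0 <= sqsum x)%E.
Proof. by apply: esum_ge0 => g _; rewrite lee_fin sqr_ge0. Qed.

Lemma normc_ge0 (z : R[i]) : 0 <= normc z.
Proof. by case: z => a b; rewrite /normc sqrtr_ge0. Qed.

Lemma esumZ_le (c : R) (f : G -> R) : 0 <= c -> (forall g, 0 <= f g) ->
  (\esum_(g in [set: G]) (c * f g)%:E <= c%:E * \esum_(g in [set: G]) (f g)%:E)%E.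
Proof.
move=> c0 f0; apply: ge_ereal_sup => _ [X [finX _] <-].
under eq_fsbigr do rewrite EFinM.
rewrite -ge0_mule_fsumr; last by move=> i; rewrite lee_fin.
by apply: lee_wpmul2l; rewrite ?lee_fin//; apply: ereal_sup_ubound; exists X.
Qed.

Lemma sqsumZ_le (a : R[i]) x :
  (sqsum (a *: x)%R <= (normc a ^+ 2)%:E * sqsum x)%E.
Proof.
apply: le_trans (esumZ_le _ _); rewrite ?sqr_ge0//; last by move=> g; rewrite sqr_ge0.
by apply: le_esum => g _; rewrite lee_fin normcM exprMn.
Qed.

Lemma sqsumD_le x y : (sqsum (x + y)%R <= 2%:E * sqsum x + 2%:E * sqsum y)%E.
Proof.
apply: (@le_trans _ _
  (\esum_(g in [set: G]) ((2 * normc (x g) ^+ 2)%:E + (2 * normc (y g) ^+ 2)%:E)%E)).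
  apply: le_esum => g _; rewrite -EFinD lee_fin.
  apply: (@le_trans _ _ ((normc (x g) + normc (y g)) ^+ 2)).
    by rewrite lerXn2r ?nnegrE ?addr_ge0 ?normc_ge0//; exact: le_normcD.
  by have := sqr_ge0 (normc (x g) - normc (y g)); lra.
rewrite esumD; first last.
- by move=> g _; rewrite lee_fin mulr_ge0// sqr_ge0.
- by move=> g _; rewrite lee_fin mulr_ge0// sqr_ge0.
by apply: leeD; apply: esumZ_le => // g; rewrite sqr_ge0.
Qed.

Lemma sqsum0 : sqsum 0 = 0%E.
Proof. by apply: esum1 => g _; rewrite [X in normc X](_ : _ = 0%C)// normc0 expr0n. Qed.

Lemma square_summable_submod : submod_closed square_summable.
Proof.
split=> [|a x y]; first by apply/asboolP; rewrite sqsum0.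
move=> /asboolP x_fin /asboolP y_fin; apply/asboolP.
apply: le_lt_trans (sqsumD_le _ _) _; apply: lte_add_pinfty; last first.
  by apply: lte_mul_pinfty.
apply: lte_mul_pinfty => //; apply: le_lt_trans (sqsumZ_le _ _) _.
by apply: lte_mul_pinfty; rewrite ?lee_fin ?sqr_ge0.
Qed.

HB.instance Definition _ :=
  GRing.isSubmodClosed.Build R[i] (G -> R[i]) square_summable square_summable_submod.

Record ell2 := Ell2 { ell2_fun :> G -> R[i]; ell2P : ell2_fun \in square_summable }.

HB.instance Definition _ := [isSub for ell2_fun].
HB.instance Definition _ := [Choice of ell2 by <:].
HB.instance Definition _ := [SubChoice_isSubLmodule of ell2 by <:].

Definition l2norm (x : ell2) : R := Num.sqrt (fine (sqsum x)).

(* Meaningful for absolutely summable families only. *)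
Definition rsum (f : G -> R) : R :=
  fine (\esum_(g in [set: G]) (f^\+ g)%:E) - fine (\esum_(g in [set: G]) (f^\- g)%:E).

(* Linear in the first argument; both families are absolutely summable by
   Cauchy-Schwarz. *)
Definition inner (x y : ell2) : R[i] :=
  rsum (fun g => complex.Re (x g * conjc (y g))) +i* rsum (fun g => complex.Im (x g * conjc (y g))).

End SquareSummable.

Section RegularRepresentations.
Context (R : realType) (G : groupType).
Implicit Types (g h : G) (x y : ell2 R G).
Local Notation H := (ell2 R G).

Lemma sqsum_delta g : sqsum (fun h : G => (h == g)%:R : R[i]) = 1%E.
Proof.
rewrite /sqsum (esumID [set g]); last by move=> *; rewrite lee_fin sqr_ge0.
rewrite setTI esum_set1 ?lee_fin ?sqr_ge0// eqxx normc1 expr1n.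
rewrite esum1 ?adde0// => h [_ /= /eqP/negPf ->].
by rewrite normc0 expr0n.
Qed.

Lemma delta_subproof g : (fun h : G => (h == g)%:R : R[i]) \in @square_summable R G.
Proof. by apply/asboolP; rewrite sqsum_delta ltry. Qed.

Definition delta g : H := Ell2 (delta_subproof g).

Lemma sqsum_reindex (f : G -> G) (x : G -> R[i]) :
  bijective f -> sqsum (x \o f) = sqsum x.
Proof.
move=> bijf; rewrite /sqsum [RHS](reindex_esum [set: G] _ f)//.
by rewrite setTT_bijective.
Qed.

Lemma mulVgl_bij g : bijective (fun h : G => (g^-1 * h)%g).
Proof. by exists (fun h => (g * h)%g) => h; rewrite ?mulVKg ?mulKg. Qed.

Lemma mulgr_bij g : bijective (fun h : G => (h * g)%g).
Proof. by exists (fun h => (h * g^-1)%g) => h; rewrite ?mulgK ?mulgVK. Qed.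

Lemma lreg_subproof g x : (fun h => x (g^-1 * h)%g) \in @square_summable R G.
Proof.
have /asboolP := ell2P x; rewrite -(sqsum_reindex _ (mulVgl_bij g)) => xfin.
exact/asboolP.
Qed.

Lemma rreg_subproof g x : (fun h => x (h * g)%g) \in @square_summable R G.
Proof.
have /asboolP := ell2P x; rewrite -(sqsum_reindex _ (mulgr_bij g)) => xfin.
exact/asboolP.
Qed.

Definition lreg g x : H := Ell2 (lreg_subproof g x).
Definition rreg g x : H := Ell2 (rreg_subproof g x).

Lemma lreg_delta g h : lreg g (delta h) = delta (g * h)%g.
Proof.
apply/val_inj/funext => a /=; congr (nat_of_bool _)%:R.
by rewrite (can2_eq (mulVKg g) (mulKg g)).
Qed.

Lemma rreg_delta g h : rreg g (delta h) = delta (h * g^-1)%g.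
Proof.
apply/val_inj/funext => a /=; congr (nat_of_bool _)%:R.
by rewrite (can2_eq (mulgK g) (mulgVK g)).
Qed.

Definition bounded_op (T : H -> H) :=
  exists C : R, forall x, l2norm (T x) <= C * l2norm x.

Definition vn_pred : {pred H -> H} := fun T =>
  `[< [/\ linear T, bounded_op T & forall g x, rreg g (T x) = T (rreg g x)] >].

Lemma l2norm_ge0 x : 0 <= l2norm x. Proof. exact: sqrtr_ge0. Qed.

Lemma l2norm_sqr x : (l2norm x ^+ 2)%:E = sqsum x.
Proof.
rewrite sqr_sqrtr ?fine_ge0 ?sqsum_ge0// fineK// ge0_fin_numE ?sqsum_ge0//.
exact/asboolP/ell2P.
Qed.

Lemma l2normD x y : l2norm (x + y) <= 2 * l2norm x + 2 * l2norm y.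
Proof.
have := sqsumD_le x y; rewrite -!l2norm_sqr -!EFinM -EFinD.
have -> : sqsum ((x : G -> R[i]) + y) = sqsum (x + y)%R by [].
rewrite -l2norm_sqr lee_fin => le2.
have x0 := l2norm_ge0 x; have y0 := l2norm_ge0 y.
rewrite -(@ler_pXn2r _ 2)// ?nnegrE ?l2norm_ge0//; last by lra.
apply: le_trans le2 _; nra.
Qed.

Lemma l2normN x : l2norm (- x) = l2norm x.
Proof.
rewrite /l2norm; congr (Num.sqrt (fine _)).
by apply: eq_esum => g _; rewrite [X in normc X](_ : _ = - x g)// normcN.
Qed.

Lemma vn_zmod : zmod_closed vn_pred.
Proof.
split=> [|S T /asboolP[linS [C hC] commS] /asboolP[linT [D hD] commT]]; apply/asboolP.
  split=> [a x y|| g x]; first by rewrite scaler0 addr0.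
    exists 0 => x; rewrite mul0r /l2norm [X in fine X](_ : _ = 0%E) ?sqrtr0//.
    exact: sqsum0.
  exact/val_inj/funext.
split=> [a x y|| g x].
- rewrite [LHS](_ : _ = S (a *: x + y) - T (a *: x + y))// linS linT.
  by rewrite [(_ - _) x](_ : _ = S x - T x)// [(_ - _) y](_ : _ = S y - T y)//
     scalerBr opprD addrACA.
- exists (2 * C + 2 * D) => x; rewrite [(_ - _) x](_ : _ = S x - T x)//.
  have := l2normD (S x) (- T x); rewrite l2normN; have := hC x; have := hD x.
  have := l2norm_ge0 x; lra.
- rewrite [RHS](_ : _ = S (rreg g x) - T (rreg g x))// -commS -commT.
  exact/val_inj/funext.
Qed.

HB.instance Definition _ := GRing.isZmodClosed.Build (H -> H) vn_pred vn_zmod.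

Record vn := Vn { vn_op :> H -> H; vnP : vn_op \in vn_pred }.

HB.instance Definition _ := [isSub for vn_op].
HB.instance Definition _ := [Choice of vn by <:].
HB.instance Definition _ := [SubChoice_isSubZmodule of vn by <:].

Lemma vn_one_subproof : (id : H -> H) \in vn_pred.
Proof. by apply/asboolP; split=> //; exists 1 => x; rewrite mul1r. Qed.

Lemma vn_mul_subproof (S T : vn) : (S \o T) \in vn_pred.
Proof.
have /asboolP[linS [C hC] commS] := vnP S; have /asboolP[linT [D hD] commT] := vnP T.
apply/asboolP; split=> [a x y||g x] /=.
- by rewrite linT linS.
- exists (`|C| * `|D|) => x; apply: le_trans (hC _) _; rewrite -mulrA.
  apply: le_trans (ler_wpM2r (l2norm_ge0 _) (ler_norm C)) _.
  apply: ler_wpM2l => //; apply: le_trans (hD _) _.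
  by apply: ler_wpM2r; rewrite ?l2norm_ge0 ?ler_norm.
- by rewrite commS commT.
Qed.

Definition vn_one : vn := Vn vn_one_subproof.
Definition vn_mul (S T : vn) : vn := Vn (vn_mul_subproof S T).

Lemma vn_mulA : associative vn_mul. Proof. by move=> S T U; exact/val_inj. Qed.
Lemma vn_mul1 : left_id vn_one vn_mul. Proof. by move=> S; exact/val_inj. Qed.
Lemma vn_1mul : right_id vn_one vn_mul. Proof. by move=> S; exact/val_inj. Qed.

Lemma vn_mulDl : left_distributive vn_mul +%R.
Proof. by move=> S T U; exact/val_inj/funext. Qed.

Lemma vn_mulDr : right_distributive vn_mul +%R.
Proof.
move=> S T U; apply/val_inj/funext => x.
have /asboolP[linS _ _] := vnP S.
have := linS 1 (T x) (U x); rewrite !scale1r; exact.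
Qed.

Lemma vn_one_neq0 : vn_one != 0.
Proof.
apply/eqP => /(congr1 (fun T : vn => T (delta 1%g) 1%g)) /eqP.
by rewrite /= eqxx oner_eq0.
Qed.

HB.instance Definition _ := GRing.Zmodule_isNzRing.Build vn
  vn_mulA vn_mul1 vn_1mul vn_mulDl vn_mulDr vn_one_neq0.

Lemma lreg_vn_subproof g : lreg g \in vn_pred.
Proof.
apply/asboolP; split=> [a x y||h x].
- exact/val_inj/funext.
- exists 1 => x; rewrite mul1r /l2norm.
  by rewrite (sqsum_reindex _ (mulVgl_bij g)).
- by apply/val_inj/funext => a /=; rewrite mulgA.
Qed.

Definition lambda g : vn := Vn (lreg_vn_subproof g).

Definition vn_trace (T : vn) : R[i] := inner (T (delta 1%g)) (delta 1%g).

Definition vn_adjoint (S T : vn) := forall x y, inner (S x) y = inner x (T y).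

End RegularRepresentations.
Arguments vn R G : clear implicits.

(* Right LG-modules are left modules over the converse ring, so that, for
   [M : lmodType (vn R G)^c], [a *: m] is m.a. *)

Section Dimension.
Context (R : realType) (G : groupType).
Local Notation LG := (vn R G).

(* The first conjunct is q^* = q: the (i, j) entry of q^* is the adjoint of the
   (j, i) entry of q. *)
Definition vn_projection n (q : 'M[LG]_n) :=
  (forall i j, vn_adjoint (q i j) (q j i)) /\ q *m q = q.

Definition rscale n (v : 'cV[LG]_n) (a : LG) : 'cV[LG]_n := \col_i (v i 0 * a).

Definition mxrange n (q : 'M[LG]_n) : set 'cV[LG]_n := range (mulmx q).

Context (M : lmodType LG^c).

Definition submodule (P : set M) :=
  P 0 /\ forall a x y, P x -> P y -> P (a *: x + y).

Definition iso_mxrange n (q : 'M[LG]_n) (P : set M) :=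
  exists phi : 'cV[LG]_n -> M,
    [/\ {in mxrange q &, {morph phi : v w / v + w}},
        {in mxrange q, forall v (a : LG), phi (rscale v a) = (a : LG^c) *: phi v}
      & set_bij (mxrange q) P phi].

(* Finitely generated projective modules are presented as q LG^n with q an
   orthogonal projection; [d] is the von Neumann dimension of [P]. *)
Definition fgproj_dim (P : set M) (d : R) :=
  submodule P /\
  exists n (q : 'M[LG]_n), [/\ vn_projection q, iso_mxrange q P
    & d = \sum_i complex.Re (vn_trace (q i i))].

Definition luck_dim : \bar R :=
  ereal_sup [set d%:E | d in [set d | exists P, fgproj_dim P d]].

End Dimension.

Lemma scale_add_sub_add (A : pzRingType) (V : lmodType A) (a : A) (x y z x' y' z' : V) :
  (a *: x + x') - (a *: y + y') + (a *: z + z') =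
  a *: (x - y + z) + (x' - y' + z').
Proof. by rewrite scalerDr scalerBr opprD (addrACA (a *: x)) (addrACA (_ - _)). Qed.

Section RightRegularModule.
Context (R : realType) (G : groupType).
Local Notation LG := (vn R G).

(* LG as a right module over itself, i.e. as a left module over LG^c. *)
Definition vnr := LG.
HB.instance Definition _ := GRing.Zmodule.on vnr.

Definition vnr_scale (a : LG^c) (T : vnr) : vnr := (T : LG) * (a : LG).

Lemma vnr_scaleA (a b : LG^c) (T : vnr) :
  vnr_scale a (vnr_scale b T) = vnr_scale (a * b) T.
Proof. exact/esym/mulrA. Qed.

Lemma vnr_scale1 : left_id (1 : LG^c) vnr_scale.
Proof. by move=> T; exact: (mulr1 (T : LG)). Qed.

Lemma vnr_scaleDr : right_distributive vnr_scale +%R.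
Proof. by move=> a S T; exact: (mulrDl (S : LG) T a). Qed.

Lemma vnr_scaleDl (T : vnr) : {morph vnr_scale^~ T : a b / a + b}.
Proof. by move=> a b; exact: (mulrDr (T : LG) a b). Qed.

HB.instance Definition _ := GRing.Zmodule_isLmodule.Build LG^c vnr
  vnr_scaleA vnr_scale1 vnr_scaleDr vnr_scaleDl.

End RightRegularModule.
Arguments vnr R G : clear implicits.

Section Cohomology.
Context (R : realType) (G : groupType).
Local Notation LG := (vn R G).
Local Notation LGr := (vnr R G).

Definition lact (g : G) (T : LGr) : LGr := lambda R g * (T : LG).

Definition coboundary0 (T : LGr) : G -> LGr := fun g => lact g T - T.

Definition coboundary1 (c : G -> LGr) : G -> G -> LGr :=
  fun g h => lact g (c h) - c (g * h)%g + c g.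

Lemma lactM g h (T : LGr) : lact (g * h)%g T = lact g (lact h T).
Proof.
apply/val_inj/funext => x; apply/val_inj/funext => a /=.
by rewrite invgM mulgA.
Qed.

Lemma lactP g (a : LG^c) (S T : LGr) : lact g (a *: S + T) = a *: lact g S + lact g T.
Proof.
rewrite /lact [LHS](mulrDr (lambda R g) ((S : LG) * (a : LG)) T).
by congr (_ + _); exact: mulrA.
Qed.

Lemma lact0 g : lact g 0 = 0. Proof. exact: (mulr0 (lambda R g)). Qed.

Lemma coboundary0P (a : LG^c) (S T : LGr) g :
  coboundary0 (a *: S + T) g = a *: coboundary0 S g + coboundary0 T g.
Proof. by rewrite /coboundary0 lactP opprD addrACA -scalerBr. Qed.

Lemma coboundary1P (a : LG^c) (c d : G -> LGr) g h :
  coboundary1 (a *: c + d) g h = a *: coboundary1 c g h + coboundary1 d g h.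
Proof.
transitivity (lact g (a *: c h + d h) - (a *: c (g * h)%g + d (g * h)%g)
    + (a *: c g + d g)); first by [].
rewrite /coboundary1 lactP.
exact: scale_add_sub_add.
Qed.

Definition cocycle1 : {pred G -> LGr} :=
  fun c => `[< forall g h, coboundary1 c g h = 0 >].

Lemma cocycle1_submod : submod_closed cocycle1.
Proof.
split=> [|a c d /asboolP c1 /asboolP d1]; apply/asboolP => g h.
  by rewrite /coboundary1 [X in lact g X](_ : _ = 0)// lact0 subr0 addr0.
by rewrite coboundary1P c1 d1 scaler0 addr0.
Qed.

HB.instance Definition _ :=
  GRing.isSubmodClosed.Build LG^c (G -> LGr) cocycle1 cocycle1_submod.

Record Z1 := MkZ1 { Z1_fun :> G -> LGr; Z1P : Z1_fun \in cocycle1 }.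

HB.instance Definition _ := [isSub for Z1_fun].
HB.instance Definition _ := [Choice of Z1 by <:].
HB.instance Definition _ := [SubChoice_isSubLmodule of Z1 by <:].

Definition B1 : {pred Z1} := fun c => `[< exists T, coboundary0 T = c >].

Lemma coboundary0_cocycle1 (T : LGr) : coboundary0 T \in cocycle1.
Proof.
apply/asboolP => g h; rewrite /coboundary1 /coboundary0 lactM.
have lactB : lact g (lact h T - T) = lact g (lact h T) - lact g T.
  exact: (mulrBr (lambda R g) _ T).
rewrite lactB [X in X + _](_ : _ = T - lact g T); last first.
  by rewrite opprB addrC addrA subrK.
by rewrite addrA subrK subrr.
Qed.

Lemma B1_submod : submod_closed B1.
Proof.
split=> [|a c d /asboolP[S Sc] /asboolP[T Td]]; apply/asboolP.
  by exists 0; apply/funext => g; rewrite /coboundary0 lact0 subr0.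
exists (a *: S + T); rewrite [RHS](_ : _ = a *: (c : G -> LGr) + d)//.
by rewrite -Sc -Td; apply/funext => g; rewrite coboundary0P.
Qed.

HB.instance Definition _ := GRing.isZmodClosed.Build Z1 B1 (GRing.submod_closedB B1_submod).

Definition H1 := Quotient.quot B1.
HB.instance Definition _ := EqQuotient.on H1.
HB.instance Definition _ := GRing.Zmodule.on H1.

Definition H1_scale (a : LG^c) (u : H1) : H1 := \pi_H1 (a *: repr u).

Lemma H1_scale_pi a (c : Z1) : H1_scale a (\pi_H1 c) = \pi_H1 (a *: c).
Proof.
apply/eqP; rewrite -[_ == _]Quotient.idealrBE -scalerBr.
have : repr (\pi_H1 c) - c \in B1 by rewrite Quotient.idealrBE reprK.
by have [B10 B1lin] := B1_submod; rewrite -[a *: _]addr0; move/B1lin; apply.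
Qed.

Lemma H1_scaleA (a b : LG^c) (u : H1) : H1_scale a (H1_scale b u) = H1_scale (a * b) u.
Proof.
elim/quotW: u => c; rewrite (H1_scale_pi b c) !H1_scale_pi.
congr \pi_H1; exact: scalerA.
Qed.

Lemma H1_scale1 : left_id (1 : LG^c) H1_scale.
Proof.
elim/quotW => c; rewrite H1_scale_pi; congr \pi_H1; exact: scale1r.
Qed.

Lemma H1_scaleDr : right_distributive H1_scale +%R.
Proof.
move=> a; elim/quotW => c; elim/quotW => d.
rewrite !H1_scale_pi -[_ + _ in LHS](raddfD \pi_H1) H1_scale_pi.
rewrite -[RHS](raddfD \pi_H1); congr \pi_H1; exact: scalerDr.
Qed.

Lemma H1_scaleDl (u : H1) : {morph H1_scale^~ u : a b / a + b}.
Proof.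
move=> a b; elim/quotW: u => c; rewrite !H1_scale_pi.
rewrite -[RHS](raddfD \pi_H1); congr \pi_H1; exact: scalerDl.
Qed.

HB.instance Definition _ := GRing.Zmodule_isLmodule.Build LG^c H1
  H1_scaleA H1_scale1 H1_scaleDr H1_scaleDl.

End Cohomology.
Arguments H1 R G : clear implicits.

(* The right LG-module structure on H^1 is (c.a)(g) = c(g) * a. *)
Definition l2_betti1 (R : realType) (G : groupType) : \bar R :=
  luck_dim (H1 R G).

Section Girth.
Context (R : realType) (G : groupType) (k : nat) (s : 'I_k -> G).

(* The letter (i, true) stands for the i-th generator of the free group on [k]
   letters and (i, false) for its inverse. *)
Definition word := seq ('I_k * bool).

Definition reduced (w : word) : bool :=
  sorted (fun l m : 'I_k * bool => m != (l.1, ~~ l.2)) w.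

Definition letter_eval (l : 'I_k * bool) : G :=
  if l.2 then s l.1 else (s l.1)^-1%g.

Definition word_eval (w : word) : G := (\prod_(l <- w) letter_eval l)%g.

Definition generates := forall g : G, exists w : word, word_eval w = g.

Definition girth : \bar R :=
  ereal_inf [set (size w)%:R%:E | w in
    [set w : word | [/\ w != [::], reduced w & word_eval w = 1%g]]].

End Girth.

(* Main.v *)
(** Let w be a shortest relation, of length l, and D in M_(1,k)(LG) the row of its
    Fox derivatives.  The map c |-> [c(s_1), ..., c(s_k)] embeds the 1-cocycles in the
    kernel of D on LG^k.  If H^1(G, LG) contains a copy of q LG^n, lifting it to cocycles
    and adding the coboundaries (a free module of rank one when G is infinite) gives a
    matrix A with D A = 0 that is injective on Q LG^(n+1), where Q = diag(q, 1).

    Scale T = A Q to a contraction, with adjoint T'.  The even powers of 1 - T'T converge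
    strongly to the projection onto ker T, which is 1 - Q by injectivity, and traciality
    gives Tr((1 - T'T)^N) - (n+1) = Tr((1 - TT')^N) - k.  As D (1 - TT') = D, the trace of
    an even power of 1 - TT' is at least ||D||_2^2 / ||D||^2.  By minimality of w the
    Fox derivatives are sums of l distinct signed terms, so that ||D||_2^2 = l and
    ||D||^2 <= l^2, whence Tr(q) + 1 <= k - 1/l.

    The real inner product Re <x, y> suffices, because only the real part of the trace
    enters the dimension.  When G is finite, H^1 vanishes by averaging. *)
From HB Require Import structures.
Require Import Defs.
From mathcomp Require Import all_boot all_order all_algebra.
From mathcomp Require Import all_classical all_reals.
From mathcomp Require Import ereal esum numfun.
From mathcomp Require Import complex generic_quotient ring_quotient.
From mathcomp Require Import ring lra zify.

Set Implicit Arguments.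
Unset Strict Implicit.
Unset Printing Implicit Defensive.

Import Order.TTheory GRing.Theory Num.Theory.
Import Normc.

Local Open Scope classical_set_scope.
Local Open Scope ring_scope.
Local Open Scope complex_scope.
Local Open Scope quotient_scope.

(** * Sums of absolutely summable real families *)

Section Rsum.
Context (R : realType) (X : choiceType).
Implicit Types (f g p q : X -> R) (c : R).
Local Notation S p := (\esum_(x in [set: X]) (p x)%:E)%E.

Definition abs_summable f := (S (fun x => `|f x|) < +oo)%E.

Lemma esum_fin_num p : (forall x, 0 <= p x) -> (S p < +oo)%E -> S p \is a fin_num.
Proof.
by move=> p0 pfin; rewrite ge0_fin_numE// esum_ge0// => x _; rewrite lee_fin.
Qed.

Lemma esumZ c p : 0 < c -> (forall x, 0 <= p x) ->
  S (fun x => c * p x) = (c%:E * S p)%E.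
Proof.
move=> c0 p0; apply/eqP; rewrite eq_le esumZ_le ?(ltW c0)//=.
have cp0 x : 0 <= c * p x by rewrite mulr_ge0// ltW.
have := esumZ_le (ltW (_ : 0 < c^-1)) cp0; rewrite invr_gt0 => /(_ c0).
rewrite (_ : S (fun x => c^-1 * (c * p x)) = S p); last first.
  by apply: eq_esum => x _; rewrite mulKf ?gt_eqF.
move=> le; apply: le_trans (lee_wpmul2l _ le) _; first by rewrite lee_fin ltW.
by rewrite muleA -EFinM mulfV ?gt_eqF// mul1e.
Qed.

Lemma abs_summable_le f p : (forall x, `|f x| <= p x) -> (S p < +oo)%E -> abs_summable f.
Proof.
by move=> fp; apply: le_lt_trans; apply: le_esum => x _; rewrite lee_fin.
Qed.

Lemma abs_summableZ c f : abs_summable f -> abs_summable (fun x => c * f x).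
Proof.
move=> sf; apply: (@abs_summable_le _ (fun x => `|c| * `|f x|)).
  by move=> x; rewrite normrM.
by apply: le_lt_trans (esumZ_le _ _) _ => //; apply: lte_mul_pinfty.
Qed.

Lemma funrpos_sub_neg f x : f x = f^\+ x - f^\- x.
Proof. by rewrite -[in LHS](funrposBneg f). Qed.

Lemma funrpos_fin f : abs_summable f -> (S (f^\+)%R < +oo)%E.
Proof.
apply: le_lt_trans; apply: le_esum => x _.
by rewrite lee_fin /funrpos ge_max ler_norm normr_ge0.
Qed.

Lemma funrneg_fin f : abs_summable f -> (S (f^\-)%R < +oo)%E.
Proof.
apply: le_lt_trans; apply: le_esum => x _.
by rewrite lee_fin /funrneg ge_max -normrN ler_norm normr_ge0.
Qed.

(** With f = p - q one has f^+ + q = p + f^-, so the sum may be computed from any splitting into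
    summable nonnegative parts. Additivity, negation and positive scaling all reduce to a suitable
    splitting. *)
Lemma rsum_sub p q : (forall x, 0 <= p x) -> (forall x, 0 <= q x) ->
  (S p < +oo)%E -> (S q < +oo)%E ->
  rsum (fun x => p x - q x) = fine (S p) - fine (S q).
Proof.
move=> p0 q0 pfin qfin; set f := fun x => p x - q x.
have sf : abs_summable f.
  apply: (@abs_summable_le _ (fun x => p x + q x)) => [x|].
    by rewrite ler_norml /f; have := p0 x; have := q0 x; lra.
  by under eq_esum do rewrite EFinD; rewrite esumD ?lte_add_pinfty// => x _; rewrite lee_fin.
have : (S (f^\+)%R + S q = S p + S (f^\-)%R)%E.
  rewrite -!esumD; do ?[by move=> x _; rewrite lee_fin ?funrpos_ge0 ?funrneg_ge0].
  apply: eq_esum => x _; rewrite -!EFinD; congr _%:E.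
  by have := funrpos_sub_neg f x; rewrite {1}/f; lra.
have fp := esum_fin_num (funrpos_ge0 f) (funrpos_fin sf).
have fn := esum_fin_num (funrneg_ge0 f) (funrneg_fin sf).
have pp := esum_fin_num p0 pfin; have qq := esum_fin_num q0 qfin.
move=> /(congr1 fine); rewrite !fineD//.
by rewrite /rsum; lra.
Qed.

Lemma rsumD f g : abs_summable f -> abs_summable g ->
  rsum (fun x => f x + g x) = rsum f + rsum g.
Proof.
move=> sf sg.
rewrite (_ : (fun x => _) = fun x => (f^\+ x + g^\+ x) - (f^\- x + g^\- x)); last first.
  apply/funext => x; rewrite {1}(funrpos_sub_neg f) {1}(funrpos_sub_neg g); lra.
have fp := funrpos_fin sf; have fn := funrneg_fin sf.
have gp := funrpos_fin sg; have gn := funrneg_fin sg.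
have Dp : S (fun x => f^\+ x + g^\+ x) = (S (f^\+)%R + S (g^\+)%R)%E.
  by rewrite -esumD// => x _; rewrite lee_fin funrpos_ge0.
have Dn : S (fun x => f^\- x + g^\- x) = (S (f^\-)%R + S (g^\-)%R)%E.
  by rewrite -esumD// => x _; rewrite lee_fin funrneg_ge0.
rewrite rsum_sub ?Dp ?Dn; first last.
- by rewrite lte_add_pinfty.
- by rewrite lte_add_pinfty.
- by move=> x; rewrite addr_ge0 ?funrneg_ge0.
- by move=> x; rewrite addr_ge0 ?funrpos_ge0.
rewrite !fineD ?esum_fin_num//; do ?[exact: funrpos_ge0 | exact: funrneg_ge0].
by rewrite /rsum; lra.
Qed.

Lemma rsumN f : abs_summable f -> rsum (fun x => - f x) = - rsum f.
Proof.
move=> sf; rewrite (_ : (fun x => _) = fun x => f^\- x - f^\+ x); last first.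
  by apply/funext => x; rewrite {1}(funrpos_sub_neg f) opprB.
rewrite rsum_sub ?(funrpos_fin sf) ?(funrneg_fin sf)//.
by rewrite /rsum; lra.
Qed.

Lemma rsumE p : (forall x, 0 <= p x) -> (S p < +oo)%E -> rsum p = fine (S p).
Proof.
move=> p0 pfin; have S0 : S (fun=> 0 : R) = 0%E by rewrite esum1.
rewrite [X in rsum X](_ : p = fun x => p x - 0); last by apply/funext => x; rewrite subr0.
by rewrite rsum_sub ?S0 ?subr0.
Qed.

Lemma rsum_pZ c f : 0 < c -> abs_summable f -> rsum (fun x => c * f x) = c * rsum f.
Proof.
move=> c0 sf.
rewrite (_ : (fun x => _) = fun x => c * f^\+ x - c * f^\- x); last first.
  by apply/funext => x; rewrite {1}(funrpos_sub_neg f); lra.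
have fp := funrpos_fin sf; have fn := funrneg_fin sf.
have p0 := funrpos_ge0 f; have n0 := funrneg_ge0 f.
rewrite rsum_sub ?esumZ//; first last.
- by rewrite lte_mul_pinfty// lee_fin ltW.
- by rewrite lte_mul_pinfty// lee_fin ltW.
- by move=> x; rewrite mulr_ge0 ?(ltW c0).
- by move=> x; rewrite mulr_ge0 ?(ltW c0).
rewrite !fineM ?esum_fin_num//= /rsum; lra.
Qed.

Lemma rsumZ c f : abs_summable f -> rsum (fun x => c * f x) = c * rsum f.
Proof.
move=> sf; have [c0|c0|<-] := ltgtP 0 c.
- exact: rsum_pZ.
- transitivity (rsum (fun x => - (- c * f x))).
    by congr rsum; apply/funext => x; rewrite mulNr opprK.
  by rewrite rsumN ?rsum_pZ ?oppr_gt0//; [lra | exact: abs_summableZ].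
- rewrite mul0r rsumE; do ?[by move=> x; rewrite mul0r].
    by rewrite esum1// => x _; rewrite mul0r.
  by rewrite esum1 ?ltry// => x _; rewrite mul0r.
Qed.

Lemma rsum1 a f : (forall x, x != a -> f x = 0) -> rsum f = f a.
Proof.
move=> f0.
have E p : (forall x, 0 <= p x) -> (forall x, x != a -> p x = 0) -> S p = (p a)%:E.
  move=> p0 pz; rewrite (esumID [set a]); last by move=> *; rewrite lee_fin.
  rewrite setTI esum_set1 ?lee_fin// esum1 ?adde0// => x [_ /= /eqP xa].
  by rewrite pz.
rewrite /rsum !E /=.
- by rewrite -funrpos_sub_neg.
- exact: funrneg_ge0.
- by move=> x /f0 fx; rewrite /funrneg fx oppr0 maxxx.
- exact: funrpos_ge0.
- by move=> x /f0 fx; rewrite /funrpos fx maxxx.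
Qed.

Lemma rsum_reindex (h : X -> X) f : bijective h -> rsum (f \o h) = rsum f.
Proof.
move=> bijh; have bij : set_bij [set: X] [set: X] h by rewrite setTT_bijective.
by rewrite /rsum; congr (fine _ - fine _); rewrite [RHS](reindex_esum _ _ _ _ bij).
Qed.

End Rsum.

(** * Real inner products and convergence in complex vector spaces *)

Section RealInnerProduct.
Context (R : realType) (V : lmodType R[i]) (d : V -> V -> R).

(** Homogeneity is asked for real scalars [c%:C] only, so that the real part of a Hermitian form
    qualifies. *)
Definition inner_product := [/\ forall x y, d x y = d y x,
  forall x y z, d (x + y) z = d x z + d y z,
  forall (c : R) x y, d (c%:C *: x) y = c * d x y,
  forall x, 0 <= d x x & forall x, d x x = 0 -> x = 0].

(** Squaring keeps square roots out of the estimates; the triangle inequality then carries a factor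
    2. *)
Definition dist2 x y := d (x - y) (x - y).

Definition converges (u : nat -> V) (x : V) := forall e, 0 < e ->
  exists N, forall n, (N <= n)%N -> dist2 (u n) x <= e.

Definition cauchy_seq (u : nat -> V) := forall e, 0 < e ->
  exists N, forall n m, (N <= n)%N -> (N <= m)%N -> dist2 (u n) (u m) <= e.

Definition complete_ip := forall u, cauchy_seq u -> exists x, converges u x.

Hypothesis ipd : inner_product.
Implicit Types (x y z : V) (u : nat -> V).

Lemma ipC x y : d x y = d y x. Proof. by case: ipd. Qed.
Lemma ipDl x y z : d (x + y) z = d x z + d y z. Proof. by case: ipd. Qed.
Lemma ipDr x y z : d z (x + y) = d z x + d z y. Proof. by rewrite ipC ipDl !(ipC z). Qed.
Lemma ipZl (c : R) x y : d (c%:C *: x) y = c * d x y. Proof. by case: ipd. Qed.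
Lemma ipZr (c : R) x y : d x (c%:C *: y) = c * d x y. Proof. by rewrite ipC ipZl ipC. Qed.
Lemma ip_ge0 x : 0 <= d x x. Proof. by case: ipd. Qed.
Lemma ip_eq0 x : d x x = 0 -> x = 0. Proof. by case: ipd => _ _ _ _; apply. Qed.

Lemma ipNl x y : d (- x) y = - d x y.
Proof. by rewrite -scaleN1r -[-1](rmorphN1 (real_complex R)) ipZl mulN1r. Qed.

Lemma ipNr x y : d x (- y) = - d x y. Proof. by rewrite ipC ipNl ipC. Qed.
Lemma ipBl x y z : d (x - y) z = d x z - d y z. Proof. by rewrite ipDl ipNl. Qed.
Lemma ipBr x y z : d z (x - y) = d z x - d z y. Proof. by rewrite ipDr ipNr. Qed.
Lemma ip0l x : d 0 x = 0. Proof. by rewrite -(subrr 0) ipBl subrr. Qed.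
Lemma ip0r x : d x 0 = 0. Proof. by rewrite ipC ip0l. Qed.

Lemma ip_suml I (r : seq I) (P : pred I) (F : I -> V) y :
  d (\sum_(i <- r | P i) F i) y = \sum_(i <- r | P i) d (F i) y.
Proof. by elim/big_rec2: _ => [|i a b _ <-]; rewrite ?ip0l ?ipDl. Qed.

Lemma ip_sumr I (r : seq I) (P : pred I) (F : I -> V) y :
  d y (\sum_(i <- r | P i) F i) = \sum_(i <- r | P i) d y (F i).
Proof. by rewrite ipC ip_suml; apply: eq_bigr => i _; rewrite ipC. Qed.

Lemma ip_sqB x y : dist2 x y = d x x + d y y - 2 * d x y.
Proof. by rewrite /dist2 ipBl !ipBr (ipC y x); lra. Qed.

Lemma ip_sqD_le x y : d (x + y) (x + y) <= 2 * d x x + 2 * d y y.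
Proof. by have := ip_ge0 (x - y); rewrite !ipBl !ipBr !ipDl !ipDr (ipC y x); lra. Qed.

Lemma ip_sum_sqr_le n (F : 'I_n -> V) :
  d (\sum_i F i) (\sum_i F i) <= n%:R * \sum_i d (F i) (F i).
Proof.
rewrite ip_suml; under eq_bigr do rewrite ip_sumr.
apply: (@le_trans _ _ (\sum_i \sum_j (d (F i) (F i) + d (F j) (F j)) / 2)).
  apply: ler_sum => i _; apply: ler_sum => j _.
  by have := ip_ge0 (F i - F j); rewrite !ipBl !ipBr (ipC (F j) (F i)); lra.
under eq_bigr do rewrite -mulr_suml big_split /= sumr_const card_ord.
rewrite -mulr_suml big_split /= sumr_const card_ord sumrMnl mulr_natl.
by move: (_ *+ n) => S; lra.
Qed.

Lemma cauchy_schwarz x y : d x y ^+ 2 <= d x x * d y y.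
Proof.
have [y0|/eqP] := eqVneq (d y y) 0; first by rewrite (ip_eq0 y0) !ip0r mulr0 expr0n.
have yy0 := ip_ge0 y => yn0.
have y0 : 0 < d y y by rewrite lt0r yy0 andbT; exact/eqP.
(* Expanded, this square is <y,y> (<x,x> <y,y> - <x,y>^2). *)
have := ip_ge0 ((d y y)%:C *: x - (d x y)%:C *: y).
rewrite !ipBl !ipBr !ipZl !(ipC _ (_%:C *: _)) !ipZl (ipC y x) => h.
have : 0 <= d y y * (d x x * d y y - d x y ^+ 2) by rewrite expr2; lra.
by rewrite pmulr_rge0// subr_ge0.
Qed.

Lemma dist2C x y : dist2 x y = dist2 y x.
Proof. by rewrite /dist2 -opprB ipNl ipNr opprK. Qed.

Lemma dist2_triangle x y z : dist2 x z <= 2 * dist2 x y + 2 * dist2 y z.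
Proof.
rewrite /dist2 (_ : x - z = (x - y) + (y - z)); last by rewrite addrA subrK.
exact: ip_sqD_le.
Qed.

Lemma converges_unique u x y : converges u x -> converges u y -> x = y.
Proof.
move=> ux uy; apply/eqP; rewrite -subr_eq0; apply/eqP/ip_eq0/eqP.
rewrite eq_le ip_ge0 andbT; apply/ler_addgt0Pl => e e0; rewrite addr0.
have e4 : 0 < e / 4 by lra.
have [N hN] := ux _ e4; have [M hM] := uy _ e4.
have := dist2_triangle x (u (maxn N M)) y; rewrite (dist2C x (u _)).
have := hN _ (leq_maxl N M); have := hM _ (leq_maxr N M).
by rewrite /dist2; lra.
Qed.

Lemma converges_comp u x (h : nat -> nat) : (forall n, (n <= h n)%N) ->
  converges u x -> converges (u \o h) x.
Proof.
move=> hh ux e /ux[N hN]; exists N => n Nn; apply: hN.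
exact: leq_trans Nn (hh n).
Qed.

Lemma convergesD u v x y : converges u x -> converges v y ->
  converges (fun n => u n + v n) (x + y).
Proof.
move=> ux vy e e0; have e4 : 0 < e / 4 by lra.
have [N hN] := ux _ e4; have [M hM] := vy _ e4.
exists (maxn N M) => n; rewrite geq_max => /andP[/hN h1 /hM h2].
have := ip_sqD_le (u n - x) (v n - y).
by rewrite addrACA -opprD; move: h1 h2; rewrite /dist2; lra.
Qed.

Lemma converges_ip u x y e : 0 < e -> converges u x ->
  exists N, forall n, (N <= n)%N -> `|d (u n) y - d x y| <= e.
Proof.
(* The threshold makes Cauchy-Schwarz yield e^2; the summand 1 covers y = 0. *)
move=> e0 ux; have d0 : 0 < e ^+ 2 / (d y y + 1).
  by rewrite divr_gt0 ?exprn_gt0// ltr_wpDl ?ip_ge0.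
have [N hN] := ux _ d0; exists N => n /hN; rewrite ler_pdivlMr ?ltr_wpDl ?ip_ge0// => h.
rewrite -(@ler_pXn2r _ 2) ?nnegrE ?(ltW e0)// real_normK ?num_real// -ipBl.
apply: le_trans (cauchy_schwarz _ _) (le_trans _ h).
by apply: ler_wpM2l; rewrite ?ip_ge0// lerDl.
Qed.

End RealInnerProduct.

Lemma converges_map (R : realType) (V W : lmodType R[i]) (d : V -> V -> R)
    (f : W -> W -> R) (T : V -> W) (C : R) (u : nat -> V) x :
  (forall x y, T (x - y) = T x - T y) -> (forall x, f (T x) (T x) <= C * d x x) ->
  (forall x, 0 <= d x x) ->
  converges d u x -> converges f (T \o u) (T x).
Proof.
move=> TB TC d0 ux e e0; have e1 : 0 < e / (`|C| + 1) by rewrite divr_gt0// ltr_wpDl.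
have [N hN] := ux _ e1; exists N => n /hN; rewrite /= /dist2 -TB.
rewrite ler_pdivlMr ?ltr_wpDl// mulrC; apply: le_trans; apply: le_trans (TC _) _.
by apply: ler_wpM2r => //; apply: le_trans (ler_norm _) _; rewrite lerDl.
Qed.

(** * Completeness of the reals *)

Section RealSequences.
Context (R : realType).
Implicit Types a : nat -> R.

Lemma real_cauchy a :
  (forall e, 0 < e -> exists N, forall n m, (N <= n)%N -> (N <= m)%N ->
     (a n - a m) ^+ 2 <= e) ->
  exists l, forall e, 0 < e -> exists N, forall n, (N <= n)%N -> (a n - l) ^+ 2 <= e.
Proof.
(* The limit is the supremum of the eventual lower bounds, that is, the lower limit of the
   sequence. *)
move=> ca; pose A := [set x : R | exists N, forall n, (N <= n)%N -> x <= a n].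
have near r : 0 < r -> exists N, forall n, (N <= n)%N -> `|a n - a N| <= r.
  move=> r0; have [N hN] := ca (r ^+ 2) (exprn_gt0 _ r0); exists N => n Nn.
  rewrite -(@ler_pXn2r _ 2) ?nnegrE ?(ltW r0)// real_normK ?num_real//.
  exact: hN.
have lowA r N : (forall n, (N <= n)%N -> `|a n - a N| <= r) -> A (a N - r).
  by move=> h; exists N => n /h; rewrite ler_norml; lra.
have upA r N : (forall n, (N <= n)%N -> `|a n - a N| <= r) -> ubound A (a N + r).
  move=> h x [M hM]; have := hM _ (leq_maxr N M); have := h _ (leq_maxl N M).
  by rewrite ler_norml; lra.
have supA : has_sup A.
  have [N hN] := near 1 ltr01.
  by split; [exists (a N - 1); exact: lowA | exists (a N + 1); exact: upA].
exists (sup A) => e e0; pose r := Num.sqrt e / 2.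
have r0 : 0 < r by rewrite divr_gt0 ?sqrtr_gt0.
have [N hN] := near r r0; exists N => n /hN; rewrite ler_norml => h.
have h1 : a N - r <= sup A by exact: (ub_le_sup supA.2 (lowA _ _ hN)).
have h2 : sup A <= a N + r by exact: (ge_sup supA.1 (upA _ _ hN)).
rewrite -[leRHS](sqr_sqrtr (ltW e0)) -real_normK ?num_real//.
rewrite lerXn2r ?nnegrE ?sqrtr_ge0//.
have -> : Num.sqrt e = r + r by rewrite /r; lra.
by rewrite ler_norml; lra.
Qed.

Lemma nonincreasing_cauchy a : (forall n, 0 <= a n) -> (forall n, a n.+1 <= a n) ->
  forall e, 0 < e -> exists N, forall n m, (N <= n)%N -> (N <= m)%N -> `|a n - a m| <= e.
Proof.
move=> a0 aS e e0; pose A := range a.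
have infA : has_inf A by split; [exists (a 0%N), 0%N | exists 0 => _ [n _ <-]].
have [_ [N _ <-] aN] := inf_adherent e0 infA.
have mono n m : (n <= m)%N -> a m <= a n.
  by move=> /subnK <-; elim: (m - n)%N => // p; exact: le_trans (aS _).
have low n : inf A <= a n by apply: ge_inf; [exact: infA.2 | exists n].
exists N => n m /mono hn /mono hm; rewrite ler_norml.
by have := low n; have := low m; lra.
Qed.

End RealSequences.

(** * Real and imaginary parts *)

Section ComplexParts.
Context (R : realType).
Implicit Types z w : R[i].

Lemma normc_sqr z : normc z ^+ 2 = complex.Re z ^+ 2 + complex.Im z ^+ 2.
Proof. by case: z => a b; rewrite /normc sqr_sqrtr// addr_ge0// sqr_ge0. Qed.

Lemma Re_mul_conj z w : complex.Re (z * conjc w) =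
  complex.Re z * complex.Re w + complex.Im z * complex.Im w.
Proof. by case: z w => a b [c d] /=; rewrite mulrN opprK. Qed.

Lemma Re_mulC_real (c : R) z w :
  complex.Re (c%:C * z * conjc w) = c * complex.Re (z * conjc w).
Proof. by case: z w => a b [e d] /=; ring. Qed.

End ComplexParts.

(** * The space l^2(G) as a complete real inner product space *)

Section EllTwo.
Context (R : realType) (G : groupType).
Local Notation H := (ell2 R G).
Implicit Types (x y z : H) (g : G).

(** The real part of [inner]. *)
Definition dot x y : R := rsum (fun g => complex.Re (x g * conjc (y g))).

Lemma sqsum_fin x : (\esum_(g in [set: G]) (normc (x g) ^+ 2)%:E < +oo)%E.
Proof. exact/asboolP/ell2P. Qed.

Lemma dot_summable x y : abs_summable (fun g => complex.Re (x g * conjc (y g))).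
Proof.
apply: (@abs_summable_le _ _ _ (fun g => normc (x g) ^+ 2 + normc (y g) ^+ 2)).
  move=> g; rewrite Re_mul_conj !normc_sqr.
  move: (complex.Re (x g)) (complex.Im (x g)) (complex.Re (y g)) (complex.Im (y g)).
  move=> a b c e; rewrite ler_norml.
  have := sqr_ge0 (a - c); have := sqr_ge0 (a + c).
  have := sqr_ge0 (b - e); have := sqr_ge0 (b + e).
  have := sqr_ge0 a; have := sqr_ge0 b; have := sqr_ge0 c; have := sqr_ge0 e.
  by lra.
under eq_esum do rewrite EFinD.
rewrite esumD ?lte_add_pinfty ?sqsum_fin// => g _; rewrite lee_fin sqr_ge0//.
Qed.

Lemma dotDl x y z : dot (x + y) z = dot x z + dot y z.
Proof.
rewrite /dot -rsumD; try exact: dot_summable.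
by congr rsum; apply/funext => g; rewrite -raddfD -mulrDl.
Qed.

Lemma dotZl (c : R) x y : dot (c%:C *: x) y = c * dot x y.
Proof.
rewrite /dot -rsumZ; last exact: dot_summable.
by congr rsum; apply/funext => g; rewrite -Re_mulC_real.
Qed.

Lemma dotxx x : (dot x x)%:E = sqsum x.
Proof.
have E : (fun g => complex.Re (x g * conjc (x g))) = fun g => normc (x g) ^+ 2.
  by apply/funext => g; rewrite Re_mul_conj normc_sqr !expr2.
rewrite /dot E rsumE ?sqsum_fin//; last by move=> g; exact: sqr_ge0.
rewrite fineK// esum_fin_num ?sqsum_fin// => g; exact: sqr_ge0.
Qed.

Lemma dot_l2norm x : dot x x = l2norm x ^+ 2.
Proof. by apply: EFin_inj; rewrite dotxx l2norm_sqr. Qed.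

(** This is what remains of sesquilinearity after taking real parts; it makes adjoints complex
    linear. *)
Lemma dot_conj_scale (a : R[i]) x y : dot (a *: x) y = dot x (conjc a *: y).
Proof.
congr rsum; apply/funext => g.
rewrite [(a *: x) g](_ : _ = a * x g)// [(_ *: y) g](_ : _ = conjc a * y g)//.
by case: a (x g) (y g) => a b [c e] [i j] /=; ring.
Qed.

Lemma dot_delta x (a : R[i]) g :
  dot x (a *: delta R g) = complex.Re (x g * conjc a).
Proof.
have E h : (a *: delta R g) h = a * (h == g)%:R by [].
rewrite /dot (rsum1 (a := g)) => [|h hg]; rewrite E; first by rewrite eqxx mulr1.
by rewrite (negPf hg) mulr0 conjc0 mulr0.
Qed.

Lemma dot_eq0 x : dot x x = 0 -> x = 0.
Proof.
move=> xx0; apply/val_inj/funext => g /=; have x0 := dotxx x; rewrite xx0 in x0.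
have : ((normc (x g) ^+ 2)%:E <= (0%R)%:E)%E.
  rewrite x0; apply: esum_ge; exists [set g].
    by split=> //; exact: finite_set1.
  by rewrite fsbig_set1.
rewrite lee_fin => /(conj (sqr_ge0 (normc (x g)))) /andP.
by rewrite -eq_le eq_sym sqrf_eq0 => /eqP/eq0_normc.
Qed.

Lemma dot_ip : inner_product (V := H) dot.
Proof.
split=> [x y|x y z|c x y|x|x].
- by congr rsum; apply/funext => g; rewrite !Re_mul_conj; ring.
- exact: dotDl.
- exact: dotZl.
- by rewrite dot_l2norm sqr_ge0.
- exact: dot_eq0.
Qed.

Lemma square_summable_bound (f : G -> R[i]) (C : R) :
  (forall s : seq G, uniq s -> \sum_(g <- s) normc (f g) ^+ 2 <= C) ->
  (sqsum f <= C%:E)%E.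
Proof.
move=> fC; apply: ge_ereal_sup => _ [A [finA _] <-].
by rewrite fsbig_finite//= sumEFin lee_fin; apply: fC; exact: finmap.fset_uniq.
Qed.

(** [f] is a bare function because truncations also serve to prove that a function is square
    summable. *)
Definition finpart (s : seq G) (f : G -> R[i]) : H := \sum_(g <- s) f g *: delta R g.

Lemma dot_finpart s x (f : G -> R[i]) :
  dot x (finpart s f) = \sum_(g <- s) complex.Re (x g * conjc (f g)).
Proof. by rewrite (ip_sumr dot_ip); apply: eq_bigr => g _; rewrite dot_delta. Qed.

Lemma ell2_sumE I (r : seq I) (P : pred I) (F : I -> H) h :
  (\sum_(i <- r | P i) F i) h = \sum_(i <- r | P i) F i h.
Proof. by elim/big_rec2: _ => [|i a b _ <-]. Qed.

Lemma finpartE s (f : G -> R[i]) h : uniq s -> h \in s -> finpart s f h = f h.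
Proof.
move=> us hs; rewrite /finpart ell2_sumE (bigD1_seq h)//.
have Z a g : (a *: delta R g) h = a * (h == g)%:R by [].
rewrite Z eqxx mulr1 big1; first exact: addr0.
by move=> g gh; rewrite Z eq_sym (negPf gh) mulr0.
Qed.

Lemma dot_finpart_diag s (f : G -> R[i]) : uniq s ->
  dot (finpart s f) (finpart s f) = \sum_(g <- s) normc (f g) ^+ 2.
Proof.
move=> us; rewrite dot_finpart big_seq [RHS]big_seq; apply: eq_bigr => g gs.
by rewrite finpartE// Re_mul_conj normc_sqr !expr2.
Qed.

Lemma dist2_finpart s x : uniq s ->
  dist2 dot x (finpart s x) = dot x x - \sum_(g <- s) normc (x g) ^+ 2.
Proof.
move=> us; rewrite (ip_sqB dot_ip) dot_finpart_diag// dot_finpart.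
have -> : \sum_(g <- s) complex.Re (x g * conjc (x g)) = \sum_(g <- s) normc (x g) ^+ 2.
  by apply: eq_bigr => g _; rewrite Re_mul_conj normc_sqr !expr2.
by lra.
Qed.

Lemma bessel s x : uniq s -> \sum_(g <- s) normc (x g) ^+ 2 <= dot x x.
Proof.
by move=> us; rewrite -subr_ge0 -dist2_finpart//; exact: (ip_ge0 dot_ip).
Qed.

Lemma normc_le_dot x g : normc (x g) ^+ 2 <= dot x x.
Proof. by have := @bessel [:: g] x isT; rewrite big_seq1. Qed.

(** If all truncations stayed farther than e from x, every finite partial sum, and hence the full
    sum, would be at most |x|^2 - e. *)
Lemma finpart_dense x e : 0 < e -> exists2 s, uniq s & dist2 dot x (finpart s x) <= e.
Proof.
move=> e0; apply: contrapT => nex.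
suff : (sqsum x <= (dot x x - e)%:E)%E by rewrite -dotxx lee_fin; lra.
apply: square_summable_bound => s us; rewrite leNgt; apply/negP => lt.
by apply: nex; exists s => //; rewrite dist2_finpart//; lra.
Qed.

Lemma normcB_sqr_le (a b c : R[i]) :
  normc (a - b) ^+ 2 <= 2 * normc (a - c) ^+ 2 + 2 * normc (c - b) ^+ 2.
Proof.
rewrite !normc_sqr; case: a b c => [a a'] [b b'] [c c'] /=.
have sq (x y z : R) : (x - y) ^+ 2 <= 2 * (x - z) ^+ 2 + 2 * (z - y) ^+ 2.
  by have := sqr_ge0 (x - z - (z - y)); lra.
by have := sq a b c; have := sq a' b' c'; lra.
Qed.

Lemma ell2_complete : complete_ip (V := H) dot.
Proof.
move=> u cu.
have coord g : exists l : R[i], forall e, 0 < e ->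
    exists N, forall n, (N <= n)%N -> normc (l - u n g) ^+ 2 <= e.
  have cc e : 0 < e -> exists N, forall n m, (N <= n)%N -> (N <= m)%N ->
      normc (u n g - u m g) ^+ 2 <= e.
    move=> /cu[N hN]; exists N => n m Nn Nm.
    exact: le_trans (normc_le_dot (u n - u m) g) (hN _ _ Nn Nm).
  have [a ha] : exists l, forall e, 0 < e -> exists N, forall n, (N <= n)%N ->
      (complex.Re (u n g) - l) ^+ 2 <= e.
    apply: real_cauchy => e /cc[N hN]; exists N => n m Nn Nm.
    apply: le_trans (hN _ _ Nn Nm); rewrite normc_sqr !raddfB /=.
    by rewrite lerDl sqr_ge0.
  have [b hb] : exists l, forall e, 0 < e -> exists N, forall n, (N <= n)%N ->
      (complex.Im (u n g) - l) ^+ 2 <= e.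
    apply: real_cauchy => e /cc[N hN]; exists N => n m Nn Nm.
    apply: le_trans (hN _ _ Nn Nm); rewrite normc_sqr !raddfB /=.
    by rewrite lerDr sqr_ge0.
  exists (a +i* b) => e e0; have e2 : 0 < e / 2 by lra.
  have [N hN] := ha _ e2; have [M hM] := hb _ e2.
  exists (maxn N M) => n; rewrite geq_max => /andP[/hN h1 /hM h2].
  rewrite normc_sqr; case: (u n g) h1 h2 => c c' /= h1 h2.
  by rewrite -(sqrrN (a - c)) -(sqrrN (b - c')) !opprB; lra.
have [f hf] := choice coord.
have seqlim s e : 0 < e -> exists M, forall m, (M <= m)%N ->
    \sum_(g <- s) normc (f g - u m g) ^+ 2 <= e.
  elim: s e => [|g s IH] e e0; first by exists 0%N => m _; rewrite big_nil ltW.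
  have e2 : 0 < e / 2 by lra.
  have [N hN] := IH _ e2; have [M hM] := hf g _ e2.
  exists (maxn N M) => n; rewrite geq_max => /andP[/hN h1 /hM h2].
  by rewrite big_cons; lra.
(* The rank N is independent of the finite set s: u n is compared with f through some u m, where
   only m depends on s. *)
have close e : 0 < e -> exists N, forall n, (N <= n)%N -> forall s, uniq s ->
    \sum_(g <- s) normc (f g - u n g) ^+ 2 <= e.
  move=> e0; have e4 : 0 < e / 4 by lra.
  have [N hN] := cu _ e4; exists N => n Nn s us.
  have [M hM] := seqlim s _ e4; pose m := maxn N M.
  have h1 := hM m (leq_maxr _ _); have h2 := hN m n (leq_maxl _ _) Nn.
  have h3 := bessel (u m - u n) us.
  apply: (@le_trans _ _ (2 * (\sum_(g <- s) normc (f g - u m g) ^+ 2) +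
      2 * (\sum_(g <- s) normc ((u m - u n) g) ^+ 2))); last first.
    by move: h1 h2 h3; rewrite /dist2; lra.
  rewrite !mulr_sumr -big_split /=; apply: ler_sum => g _; exact: normcB_sqr_le.
have fP : f \in @square_summable R G.
  have [N hN] := close 1 ltr01; apply/asboolP.
  apply: (@le_lt_trans _ _ (2 * 1 + 2 * dot (u N) (u N))%:E); last exact: ltry.
  apply: square_summable_bound => s us.
  have h := hN N (leqnn _) s us; have h' := bessel (u N) us.
  apply: (@le_trans _ _ (2 * (\sum_(g <- s) normc (f g - u N g) ^+ 2) +
      2 * (\sum_(g <- s) normc (u N g) ^+ 2))); last by lra.
  rewrite !mulr_sumr -big_split /=; apply: ler_sum => g _.
  by have := normcB_sqr_le (f g) 0 (u N g); rewrite !subr0.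
exists (Ell2 fP) => e /close[N hN]; exists N => n /hN h.
rewrite (dist2C dot_ip) -lee_fin dotxx.
exact: square_summable_bound.
Qed.

Lemma dot_lreg g x y : dot (lreg g x) (lreg g y) = dot x y.
Proof.
rewrite /dot -[RHS](rsum_reindex (h := fun h => (g^-1 * h)%g)) //.
exact: mulVgl_bij.
Qed.

Lemma rreg_invK g x : rreg g (rreg g^-1 x) = x.
Proof. by apply/val_inj/funext => h /=; rewrite mulgK. Qed.

Lemma dot_rreg g x y : dot (rreg g x) (rreg g y) = dot x y.
Proof.
rewrite /dot -[RHS](rsum_reindex (h := fun h => (h * g)%g)) //.
exact: mulgr_bij.
Qed.

End EllTwo.

(** * Adjoints of elements of LG *)

Section Adjoint.
Context (R : realType) (G : groupType).
Local Notation H := (ell2 R G).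
Local Notation LG := (vn R G).
Local Notation dot := (@dot R G).
Local Notation dip := (@dot_ip R G).
Implicit Types (x y z : H) (g : G) (S T : LG).

Lemma vn_axioms S : [/\ linear S, bounded_op S & forall g x, rreg g (S x) = S (rreg g x)].
Proof. exact/asboolP/vnP. Qed.

Lemma vnD S x y : S (x + y) = S x + S y.
Proof. by have [lin _ _] := vn_axioms S; have := lin 1 x y; rewrite !scale1r. Qed.

Lemma vn0 S : S 0 = 0.
Proof. by apply: (addrI (S 0)); rewrite -vnD !addr0. Qed.

Lemma vnZ S (a : R[i]) x : S (a *: x) = a *: S x.
Proof. by have [lin _ _] := vn_axioms S; have := lin a x 0; rewrite !addr0 vn0 addr0. Qed.

Lemma vnB S x y : S (x - y) = S x - S y.
Proof. by rewrite vnD -scaleN1r vnZ scaleN1r. Qed.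

Lemma vn_suml S I (r : seq I) (P : pred I) (F : I -> H) :
  S (\sum_(i <- r | P i) F i) = \sum_(i <- r | P i) S (F i).
Proof. exact: (big_morph S (vnD S) (vn0 S)). Qed.

Lemma sum_vnE I (r : seq I) (P : pred I) (F : I -> LG) x :
  (\sum_(i <- r | P i) F i) x = \sum_(i <- r | P i) F i x.
Proof. by elim/big_rec2: _ => [|i a b _ <-]. Qed.

Lemma vn_rreg S g x : S (rreg g x) = rreg g (S x).
Proof. by have [_ _ ->] := vn_axioms S. Qed.

Lemma vn_bounded S : exists2 C, 0 <= C & forall x, dot (S x) (S x) <= C * dot x x.
Proof.
have [_ [C hC] _] := vn_axioms S; exists (C ^+ 2) => [|x]; first exact: sqr_ge0.
rewrite !dot_l2norm -exprMn -[leLHS]ger0_norm ?sqr_ge0// -[leRHS]ger0_norm ?sqr_ge0//.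
rewrite !normrX ler_sqr ?nnegrE//.
rewrite ger0_norm ?l2norm_ge0//; apply: le_trans (hC x) _; exact: ler_norm.
Qed.

Lemma vn_predP (f : H -> H) (C : R) : linear f -> 0 <= C ->
  (forall x, dot (f x) (f x) <= C * dot x x) ->
  (forall g x, rreg g (f x) = f (rreg g x)) -> f \in @vn_pred R G.
Proof.
move=> lin C0 bnd eqv; apply/asboolP; split=> //; exists (Num.sqrt C) => x.
rewrite -(@ler_pXn2r _ 2) ?nnegrE ?l2norm_ge0 ?mulr_ge0 ?sqrtr_ge0 ?l2norm_ge0//.
by rewrite exprMn (sqr_sqrtr C0) -!dot_l2norm.
Qed.

Lemma dot_nondeg x y : (forall z, dot z x = dot z y) -> x = y.
Proof.
move=> h; apply/eqP; rewrite -subr_eq0; apply/eqP/(ip_eq0 dip).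
by rewrite (ipBr dip) h subrr.
Qed.

(** The coefficient at g of the adjoint applied to y: pairing with delta_g recovers its real part,
    pairing with i delta_g its imaginary part. *)
Definition adj_fun S y : G -> R[i] := fun g =>
  dot y (S (delta R g)) +i* dot y (S ('i%C *: delta R g)).

Lemma adj_funE S y (z : R[i]) g :
  complex.Re (z * conjc (adj_fun S y g)) = dot y (S (z *: delta R g)).
Proof.
rewrite Re_mul_conj /= [in RHS](complexE z) scalerDl vnD (ipDr dip).
by rewrite [in RHS](mulrC 'i%C) -scalerA !vnZ !(ipZr dip).
Qed.

(** Let w be a truncation of the adjoint vector and A = |w|^2. Then <y, S w> = A, so Cauchy-Schwarz
    gives A^2 <= |y|^2 C A, and A cancels. *)
Lemma adj_fun_bound S y C : 0 <= C -> (forall x, dot (S x) (S x) <= C * dot x x) ->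
  (sqsum (adj_fun S y) <= (C * dot y y)%:E)%E.
Proof.
move=> C0 hC; apply: square_summable_bound => s us.
set A := \sum_(g <- s) _; pose w := finpart s (adj_fun S y).
have ww : dot w w = A by exact: dot_finpart_diag.
have yw : dot y (S w) = A.
  rewrite vn_suml (ip_sumr dip); apply: eq_bigr => g _.
  by rewrite -adj_funE Re_mul_conj normc_sqr !expr2.
have A0 : 0 <= A by rewrite -ww (ip_ge0 dip).
have := cauchy_schwarz dip y (S w); rewrite yw => cs.
have {}cs : A * A <= A * (C * dot y y).
  have := ler_wpM2l (ip_ge0 dip y) (hC w); rewrite ww => h.
  by rewrite -expr2; apply: le_trans cs (le_trans h _); lra.
have [->|An0] := eqVneq A 0; first by rewrite mulr_ge0// (ip_ge0 dip).
by rewrite -(ler_pM2l (_ : 0 < A))// lt0r An0.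
Qed.

Lemma adj_subproof S y : adj_fun S y \in @square_summable R G.
Proof.
have [C C0 hC] := vn_bounded S; apply/asboolP.
exact: le_lt_trans (adj_fun_bound y C0 hC) (ltry _).
Qed.

Definition adj S y : H := Ell2 (adj_subproof S y).

(** The identity holds on finitely supported vectors by construction, and both sides are continuous
    in x. *)
Lemma dot_adj S x y : dot (S x) y = dot x (adj S y).
Proof.
have [C C0 hC] := vn_bounded S.
have fin s : dot (S (finpart s x)) y = dot (finpart s x) (adj S y).
  rewrite vn_suml !(ip_suml dip); apply: eq_bigr => g _.
  rewrite (ipC dip) -adj_funE (ipC dip) dot_delta !Re_mul_conj.
  by rewrite (mulrC (complex.Re _)) (mulrC (complex.Im _)).
apply/eqP; rewrite -subr_eq0 -sqrf_eq0 eq_le sqr_ge0 andbT.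
apply/ler_addgt0Pl => e e0; rewrite addr0.
(* The constant comes from (a - b)^2 <= 2 a^2 + 2 b^2 and Cauchy-Schwarz for each term; the final 1
   makes it positive. *)
set K := 2 * (C * dot y y + dot (adj S y) (adj S y)) + 1.
have K0 : 0 < K.
  by rewrite ltr_wpDl// mulr_ge0// addr_ge0 ?mulr_ge0 ?(ip_ge0 dip).
have [s us hs] := finpart_dense x (divr_gt0 e0 K0).
set w := x - finpart s x; have hw : dot w w * K <= e by rewrite -ler_pdivlMr.
have -> : dot (S x) y - dot x (adj S y) = dot (S w) y - dot w (adj S y).
  by rewrite vnB !(ipBl dip) fin; lra.
have c1 := cauchy_schwarz dip (S w) y; have c2 := cauchy_schwarz dip w (adj S y).
have c3 : dot (S w) (S w) * dot y y <= C * dot w w * dot y y.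
  by apply: ler_wpM2r; rewrite ?(ip_ge0 dip).
have w0 := ip_ge0 dip w.
have c4 := sqr_ge0 (dot (S w) y + dot w (adj S y)).
apply: le_trans _ hw; rewrite /K; move: c1 c2 c3 c4 w0.
by move: (dot (S w) y) (dot w (adj S y)) => a b; lra.
Qed.

Lemma star_subproof S : adj S \in @vn_pred R G.
Proof.
have [C C0 hC] := vn_bounded S; apply: (@vn_predP _ C) => //.
- move=> a x y; apply: dot_nondeg => z; rewrite -dot_adj !(ipDr dip) -dot_adj; congr (_ + _).
  have scaler u v : dot u (a *: v) = dot (conjc a *: u) v by rewrite dot_conj_scale conjcK.
  by rewrite !scaler -dot_adj vnZ.
- by move=> y; rewrite -lee_fin dotxx; exact: adj_fun_bound.
- move=> g y; apply: dot_nondeg => z; rewrite -dot_adj.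
  by rewrite -{1}(rreg_invK g z) dot_rreg -dot_adj vn_rreg -(dot_rreg g) rreg_invK.
Qed.

End Adjoint.

(** * The real part of the trace on LG *)

Section Trace.
Context (R : realType) (G : groupType).
Local Notation H := (ell2 R G).
Local Notation LG := (vn R G).
Local Notation dot := (@dot R G).
Local Notation dip := (@dot_ip R G).
Implicit Types (x y z : H) (g : G) (S T : LG).

Definition star S : LG := Vn (star_subproof S).

Lemma dot_star S x y : dot (S x) y = dot x (star S y).
Proof. exact: dot_adj. Qed.

Lemma dot_vn_adjoint S T x y : vn_adjoint S T -> dot (S x) y = dot x (T y).
Proof. by move=> /(_ x y) /(congr1 (@complex.Re R)). Qed.

Local Notation delta1 := (delta R (1%g : G)).

Definition retr S : R := dot (S delta1) delta1.

Lemma retrE S : complex.Re (vn_trace S) = retr S. Proof. by []. Qed.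

Lemma retrD S T : retr (S + T) = retr S + retr T.
Proof. exact: (ipDl dip). Qed.

Lemma retr0 : retr 0 = 0. Proof. exact: (ip0l dip). Qed.

Lemma retr_sum I (r : seq I) (P : pred I) (F : I -> LG) :
  retr (\sum_(i <- r | P i) F i) = \sum_(i <- r | P i) retr (F i).
Proof. exact: (big_morph retr retrD retr0). Qed.

Lemma dot_delta1 x g : dot x (delta R g) = complex.Re (x g).
Proof. by rewrite -[delta R g]scale1r dot_delta conjc1 mulr1. Qed.

Lemma retr1 : retr 1 = 1.
Proof. by rewrite /retr dot_delta1 /= eqxx. Qed.

(** Since S commutes with right translations, the vector S delta_1 determines all its matrix
    coefficients. *)
Lemma vn_delta S g h : S (delta R g) h = S delta1 (h * g^-1)%g.
Proof.
have -> : delta R g = rreg g^-1 (delta R 1%g) :> H by rewrite rreg_delta invgK mul1g.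
by rewrite vn_rreg.
Qed.

Lemma star_delta S g : star S delta1 g = conjc (S delta1 g^-1%g).
Proof.
rewrite [LHS](_ : _ = adj_fun S delta1 g)// /adj_fun vnZ !(ipC dip delta1) !dot_delta1.
rewrite (_ : ('i%C *: S (delta R g)) 1%g = 'i%C * S (delta R g) 1%g)// (vn_delta S g 1%g) mul1g.
by case: (S _ _) => a b /=; congr (_ +i* _); ring.
Qed.

(** In terms of the vectors a = A delta_1 and b = B delta_1, the trace of A B is the sum of Re (b(g)
    a(g^-1)); the substitution of g^-1 for g exchanges the factors. *)
Lemma retr_mulC S T : retr (S * T) = retr (T * S).
Proof.
have E A B : retr (A * B) =
    rsum (fun g => complex.Re (B delta1 g * A delta1 g^-1%g)).
  rewrite /retr -[(A * B) _]/(A (B delta1)) dot_star.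
  by congr rsum; apply/funext => g; rewrite star_delta conjcK.
rewrite !E -[RHS](rsum_reindex (h := fun g : G => g^-1%g)); last first.
  by exists (fun g : G => g^-1%g) => g; rewrite invgK.
by congr rsum; apply/funext => g /=; rewrite invgK mulrC.
Qed.

End Trace.

(** * Matrices over LG acting on finite powers of l^2(G) *)

Section MatrixAction.
Context (R : realType) (G : groupType).
Local Notation H := (ell2 R G).
Local Notation LG := (vn R G).
Local Notation dot := (@dot R G).
Local Notation dip := (@dot_ip R G).
Local Notation delta1 := (delta R (1%g : G)).

Definition dotv m (v w : 'I_m -> H) : R := \sum_i dot (v i) (w i).

Lemma dotv_ip m : inner_product (V := 'I_m -> H) (@dotv m).
Proof.
split=> [v w|v w z|c v w|v|v v0].
- by apply: eq_bigr => i _; rewrite (ipC dip).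
- by rewrite /dotv -big_split; apply: eq_bigr => i _; exact: (ipDl dip).
- by rewrite /dotv mulr_sumr; apply: eq_bigr => i _; exact: (ipZl dip).
- by apply: sumr_ge0 => i _; exact: (ip_ge0 dip).
- apply/funext => i; apply: (ip_eq0 dip); apply/eqP; rewrite eq_le (ip_ge0 dip) andbT.
  rewrite -v0 /dotv (bigD1 i)//= lerDl; apply: sumr_ge0 => j _; exact: (ip_ge0 dip).
Qed.

Lemma dot_le_dotv m (v : 'I_m -> H) i : dot (v i) (v i) <= dotv v v.
Proof.
by rewrite /dotv (bigD1 i)//= lerDl; apply: sumr_ge0 => j _; exact: (ip_ge0 dip).
Qed.

Lemma dotv_complete m : complete_ip (V := 'I_m -> H) (@dotv m).
Proof.
move=> u cu.
have limi i : exists l, converges dot (fun n => u n i) l.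
  apply: ell2_complete => e /cu[N hN]; exists N => n p Nn Np.
  by apply: le_trans (hN _ _ Nn Np); rewrite /dist2; exact: (dot_le_dotv (u n - u p)).
have [x hx] := choice limi.
(* Dividing by m + 1 instead of m covers m = 0. *)
exists x => e e0; have em : 0 < e / m.+1%:R by rewrite divr_gt0.
have [N hN] := choice (fun i => hx i _ em).
exists (\max_i N i)%N => n Nn; rewrite /dist2 /dotv.
apply: (@le_trans _ _ (\sum_(i < m) e / m.+1%:R)).
  by apply: ler_sum => i _; apply: hN; apply: leq_trans Nn; exact: leq_bigmax.
rewrite sumr_const card_ord -[leLHS]mulr_natr mulrAC ler_pdivrMr// ler_pM2l// ler_nat.
exact: leqnSn.
Qed.

Definition single m (j : 'I_m) (x : H) : 'I_m -> H := fun i => if i == j then x else 0.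

Lemma dotv_single m (v : 'I_m -> H) j x : dotv v (single j x) = dot (v j) x.
Proof.
rewrite /dotv (bigD1 j)//= /single eqxx big1 ?addr0// => i /negPf ->.
exact: (ip0r dip).
Qed.

Lemma sum_single m (v : 'I_m -> H) : v = \sum_j single j (v j).
Proof.
apply/funext => i; rewrite (big_morph (fun f : 'I_m -> H => f i) (id1 := 0) (op1 := +%R))//.
rewrite (bigD1 i)//= /single eqxx big1 ?addr0// => j.
by rewrite eq_sym => /negPf ->.
Qed.

Definition mact k m (A : 'M[LG]_(k, m)) (v : 'I_m -> H) : 'I_k -> H :=
  fun i => \sum_j A i j (v j).

Lemma mactD k m (A : 'M[LG]_(k, m)) v w : mact A (v + w) = mact A v + mact A w.
Proof.
apply/funext => i; rewrite /mact [RHS](_ : _ = mact A v i + mact A w i)//.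
by rewrite /mact -big_split; apply: eq_bigr => j _; exact: vnD.
Qed.

Lemma mactZ k m (A : 'M[LG]_(k, m)) (a : R[i]) v : mact A (a *: v) = a *: mact A v.
Proof.
apply/funext => i; rewrite [RHS](_ : _ = a *: mact A v i)// /mact scaler_sumr.
by apply: eq_bigr => j _; exact: vnZ.
Qed.

Lemma mactB k m (A : 'M[LG]_(k, m)) v w : mact A (v - w) = mact A v - mact A w.
Proof. by rewrite -scaleN1r mactD mactZ scaleN1r. Qed.

Lemma mact_mulmx k m n (A : 'M[LG]_(k, m)) (B : 'M[LG]_(m, n)) v :
  mact (A *m B) v = mact A (mact B v).
Proof.
apply/funext => i; rewrite /mact.
under eq_bigr do rewrite mxE sum_vnE.
rewrite exchange_big /=; apply: eq_bigr => j _.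
by rewrite vn_suml.
Qed.

Lemma mact_subl k m (A B : 'M[LG]_(k, m)) v : mact (A - B) v = mact A v - mact B v.
Proof.
apply/funext => i; rewrite [RHS](_ : _ = mact A v i - mact B v i)// /mact -sumrB.
by apply: eq_bigr => j _; rewrite !mxE.
Qed.

Lemma mact0 k m v : mact (0 : 'M[LG]_(k, m)) v = 0.
Proof. by apply/funext => i; rewrite /mact big1// => j _; rewrite mxE. Qed.

Lemma mact1 m v : mact (1%:M : 'M[LG]_m) v = v.
Proof.
apply/funext => i; rewrite /mact (bigD1 i)//= mxE eqxx big1 ?addr0// => j.
by rewrite mxE eq_sym => /negPf ->.
Qed.

Lemma mact_single k m (A : 'M[LG]_(k, m)) j x i : mact A (single j x) i = A i j x.
Proof.
rewrite /mact (bigD1 j)//= /single eqxx big1 ?addr0// => l /negPf ->.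
exact: vn0.
Qed.

Lemma mact_inj k m (A B : 'M[LG]_(k, m)) : (forall v, mact A v = mact B v) -> A = B.
Proof.
move=> AB; apply/matrixP => i j; apply/val_inj/funext => x.
by have := congr1 (fun f : 'I_k -> H => f i) (AB (single j x)); rewrite !mact_single.
Qed.

Definition starmx k m (A : 'M[LG]_(k, m)) : 'M[LG]_(m, k) := \matrix_(i, j) star (A j i).

Lemma dotv_star k m (A : 'M[LG]_(k, m)) v w :
  dotv (mact A v) w = dotv v (mact (starmx A) w).
Proof.
rewrite /dotv /mact.
under eq_bigr do rewrite (ip_suml dip).
rewrite exchange_big; apply: eq_bigr => j _ /=; rewrite (ip_sumr dip).
by apply: eq_bigr => i _; rewrite dot_star mxE.
Qed.

Lemma dotv_adjoint m (A B : 'M[LG]_m) v w :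
  (forall i j, vn_adjoint (A i j) (B j i)) -> dotv (mact A v) w = dotv v (mact B w).
Proof.
move=> AB; have <- : starmx A = B; last exact: dotv_star.
apply/matrixP => i j; rewrite mxE; apply/val_inj/funext => x.
apply: dot_nondeg => z; rewrite -(dot_vn_adjoint z x (AB j i)).
exact/esym/dot_star.
Qed.

Lemma mact_bounded k m (A : 'M[LG]_(k, m)) :
  exists2 C, 0 <= C & forall v, dotv (mact A v) (mact A v) <= C * dotv v v.
Proof.
have entry i j : exists c, 0 <= c /\ forall x, dot (A i j x) (A i j x) <= c * dot x x.
  by have [c c0 hc] := vn_bounded (A i j); exists c.
have entries i : exists c : 'I_m -> R, forall j,
    0 <= c j /\ forall x, dot (A i j x) (A i j x) <= c j * dot x x.
  by have [c hc] := choice (entry i); exists c.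
have [C hC] := choice entries.
exists (\sum_i m%:R * \sum_j C i j) => [|v].
  apply: sumr_ge0 => i _; rewrite mulr_ge0//; apply: sumr_ge0 => j _.
  by case: (hC i j).
rewrite {1}/dotv mulr_suml; apply: ler_sum => i _.
apply: le_trans (ip_sum_sqr_le dip _) _.
rewrite -mulrA ler_wpM2l// mulr_suml; apply: ler_sum => j _.
have [C0 h] := hC i j.
by apply: le_trans (h _) _; rewrite ler_wpM2l// dot_le_dotv.
Qed.

Definition mtr m (A : 'M[LG]_m) : R := \sum_i retr (A i i).

Lemma mtrE m (A : 'M[LG]_m) :
  mtr A = \sum_i dotv (mact A (single i delta1)) (single i delta1).
Proof. by apply: eq_bigr => i _; rewrite dotv_single mact_single. Qed.

Lemma mtrD m (A B : 'M[LG]_m) : mtr (A + B) = mtr A + mtr B.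
Proof. by rewrite /mtr -big_split; apply: eq_bigr => i _; rewrite mxE retrD. Qed.

Lemma mtr1 m : mtr (1%:M : 'M[LG]_m) = m%:R.
Proof.
rewrite /mtr -[in RHS](card_ord m) -sumr_const; apply: eq_bigr => i _.
by rewrite mxE eqxx retr1.
Qed.

Lemma mtr_mulC k m (A : 'M[LG]_(k, m)) (B : 'M[LG]_(m, k)) :
  mtr (A *m B) = mtr (B *m A).
Proof.
rewrite /mtr; under eq_bigr do rewrite mxE retr_sum.
rewrite exchange_big; apply: eq_bigr => j _ /=; rewrite mxE retr_sum.
by apply: eq_bigr => i _; rewrite retr_mulC.
Qed.

End MatrixAction.

(** * Powers of a symmetric contraction *)

Section ContractionPowers.
Context (R : realType) (V : lmodType R[i]) (d : V -> V -> R) (y : V -> V).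
Hypothesis ipd : inner_product d.
Hypothesis cpl : complete_ip d.
Hypothesis y_sym : forall u v, d (y u) v = d u (y v).
Hypothesis y_contr : forall v, d (y v) (y v) <= d v v.

Lemma iter_sym n u v : d (iter n y u) v = d u (iter n y v).
Proof. by elim: n u v => //= n IH u v; rewrite y_sym IH -iterSr. Qed.

Lemma iter_contr n v : d (iter n y v) (iter n y v) <= d v v.
Proof. by elim: n => //= n; exact: le_trans. Qed.

(* Even powers only: < y^(2n) v, y^(2m) v > = |y^(n+m) v|^2, so that the squared
   distances are controlled by a nonincreasing sequence. *)
Lemma even_powers_converge v : exists x, converges d (fun n => iter n.*2 y v) x.
Proof.
pose b n := d (iter n y v) (iter n y v).
have bB n p : d (iter n.*2 y v) (iter p.*2 y v) = b (n + p)%N.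
  rewrite /b !iter_sym -!iterD.
  by congr (d _ (iter _ y v)); lia.
apply: cpl => e e0.
have [N hN] : exists N, forall n m, (N <= n)%N -> (N <= m)%N -> `|b n - b m| <= e / 2.
  apply: nonincreasing_cauchy => [n|n|]; [exact: (ip_ge0 ipd) | exact: y_contr | lra].
exists N => n p Nn Np; rewrite (ip_sqB ipd) !bB.
have h1 := hN (n + n)%N (n + p)%N; have h2 := hN (p + p)%N (n + p)%N.
have {}h1 := h1 (leq_trans Nn (leq_addr _ _)) (leq_trans Nn (leq_addr _ _)).
have {}h2 := h2 (leq_trans Np (leq_addr _ _)) (leq_trans Nn (leq_addr _ _)).
by move: h1 h2; rewrite !ler_norml; lra.
Qed.

End ContractionPowers.

(** * Bounded equivariant operators as matrices over LG *)

Section OperatorMatrix.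
Context (R : realType) (G : groupType).
Local Notation H := (ell2 R G).
Local Notation LG := (vn R G).
Local Notation dot := (@dot R G).
Local Notation dip := (@dot_ip R G).
Local Notation vip := (@dotv_ip R G).

Definition rregv m (g : G) (v : 'I_m -> H) : 'I_m -> H := fun i => rreg g (v i).

Lemma mact_rregv k m (A : 'M[LG]_(k, m)) g v :
  mact A (rregv g v) = rregv g (mact A v).
Proof.
apply/funext => i; rewrite /mact /rregv.
rewrite (big_morph (rreg g) (op1 := +%R) (id1 := 0)); first last.
- exact/val_inj/funext.
- by move=> x y; exact/val_inj/funext.
by apply: eq_bigr => j _; exact: vn_rreg.
Qed.

Lemma dotv_rregv m g (v w : 'I_m -> H) : dotv (rregv g v) (rregv g w) = dotv v w.
Proof. by apply: eq_bigr => i _; exact: dot_rreg. Qed.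

Lemma rregvB m g (v w : 'I_m -> H) : rregv g (v - w) = rregv g v - rregv g w.
Proof. by apply/funext => i; exact/val_inj/funext. Qed.

Lemma rregv_single m g (j : 'I_m) (x : H) : rregv g (single j x) = single j (rreg g x).
Proof.
apply/funext => i; rewrite /rregv /single; case: ifP => // _.
exact/val_inj/funext.
Qed.

Lemma dotv_scale m (a : R[i]) (v : 'I_m -> H) :
  dotv (a *: v) (a *: v) = normc a ^+ 2 * dotv v v.
Proof.
rewrite /dotv mulr_sumr; apply: eq_bigr => i _.
rewrite [(a *: v) i](_ : _ = a *: v i)// dot_conj_scale scalerA.
have -> : conjc a * a = (normc a ^+ 2)%:C.
  by rewrite normc_sqr; case: a => b c; apply/eqP; rewrite eq_complex /=; apply/andP; split;
    apply/eqP; ring.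
by rewrite (ipZr dip).
Qed.

Lemma single_linear m (j : 'I_m) (a : R[i]) (x y : H) :
  single j (a *: x + y) = a *: single j x + single j y.
Proof.
apply/funext => i; rewrite [RHS](_ : _ = a *: single j x i + single j y i)// /single.
by case: ifP => // _; rewrite scaler0 addr0.
Qed.

(** Restricting to one summand and projecting to another preserves linearity, the bound and
    equivariance, so each entry lies in LG. This turns strong limits and scalar multiples of
    matrices back into matrices. *)
Lemma operator_matrix k m (f : ('I_m -> H) -> ('I_k -> H)) (C : R) :
  (forall (a : R[i]) u v, f (a *: u + v) = a *: f u + f v) -> 0 <= C ->
  (forall v, dotv (f v) (f v) <= C * dotv v v) ->
  (forall g v, f (rregv g v) = rregv g (f v)) ->
  exists A : 'M[LG]_(k, m), forall v, mact A v = f v.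
Proof.
move=> lin C0 bnd eqv.
have entryP i j : (fun x => f (single j x) i) \in @vn_pred R G.
  apply: (@vn_predP _ _ _ C) => [a x y||x|g x] //.
  - by rewrite single_linear lin.
  - apply: le_trans (dot_le_dotv _ i) _; apply: le_trans (bnd _) _.
    by rewrite dotv_single /single eqxx.
  - by rewrite -rregv_single eqv.
exists (\matrix_(i, j) Vn (entryP i j)) => v; apply/funext => i; rewrite /mact.
have fD u w : f (u + w) = f u + f w by have := lin 1 u w; rewrite !scale1r.
have f0 : f 0 = 0 by apply: (addrI (f 0)); rewrite -fD !addr0.
rewrite {2}(sum_single v) (big_morph f fD f0).
rewrite (big_morph (fun h : 'I_k -> H => h i) (id1 := 0) (op1 := +%R))//.
by apply: eq_bigr => j _; rewrite mxE.
Qed.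

End OperatorMatrix.

(** * The trace inequality for D A = 0 *)

Section TraceInequality.
Context (R : realType) (G : groupType).
Local Notation H := (ell2 R G).
Local Notation LG := (vn R G).
Local Notation vip := (@dotv_ip R G).
Local Notation delta1 := (delta R (1%g : G)).

Definition mxpow m (A : 'M[LG]_m) n : 'M[LG]_m := iter n (mulmx A) 1%:M.

Lemma mact_mxpow m (A : 'M[LG]_m) n v : mact (mxpow A n) v = iter n (mact A) v.
Proof. by elim: n => [|n IH]; rewrite /mxpow /= ?mact1// mact_mulmx -IH. Qed.

(** For a = [starmx T] w one has |a|^2 = <T a, w>, and Cauchy-Schwarz with |T a| <= |a| lets one
    factor |a| cancel. *)
Lemma star_contraction k m (T : 'M[LG]_(k, m)) :
  (forall v, dotv (mact T v) (mact T v) <= dotv v v) ->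
  forall w, dotv (mact (starmx T) w) (mact (starmx T) w) <= dotv w w.
Proof.
move=> hT w; set a := mact _ w.
have aE : dotv a a = dotv (mact T a) w by rewrite dotv_star.
have := cauchy_schwarz (vip k) (mact T a) w; rewrite -aE => cs.
have [->|an0] := eqVneq (dotv a a) 0; first exact: (ip_ge0 (vip k)).
have a0 : 0 < dotv a a by rewrite lt0r an0 (ip_ge0 (vip m)).
rewrite -(ler_pM2l a0) -expr2; apply: le_trans cs _.
by apply: ler_wpM2r => //; exact: (ip_ge0 (vip k)).
Qed.

Section OneMinusSquare.
Context (k m : nat) (T : 'M[LG]_(k, m)) (T' : 'M[LG]_(m, k)).
Hypothesis adjT : forall v w, dotv (mact T v) w = dotv v (mact T' w).
Hypothesis contrT' : forall w, dotv (mact T' w) (mact T' w) <= dotv w w.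
Local Notation y := (1%:M - T' *m T).

Lemma one_sub_sym v w : dotv (mact y v) w = dotv v (mact y w).
Proof.
rewrite !mact_subl !mact1 !mact_mulmx (ipBl (vip m)) (ipBr (vip m)) -adjT.
by rewrite (ipC (vip m) (mact T' _)) -adjT (ipC (vip k)).
Qed.

(** The left side is |v|^2 - 2 |T v|^2 + |T' T v|^2. The gain |T v|^2 shows that a vector whose norm
    is preserved lies in ker T. *)
Lemma one_sub_contr v : dotv (mact y v) (mact y v) <= dotv v v - dotv (mact T v) (mact T v).
Proof.
rewrite mact_subl mact1 mact_mulmx -[leLHS]/(dist2 (@dotv R G m) _ _) (ip_sqB (vip m)).
have := contrT' (mact T v); rewrite -(adjT v); lra.
Qed.

Lemma one_sub_contr1 v : dotv (mact y v) (mact y v) <= dotv v v.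
Proof.
apply: le_trans (one_sub_contr v) _; rewrite lerBlDr lerDl; exact: (ip_ge0 (vip k)).
Qed.

(** The strong limit of the even powers is linear, bounded and equivariant, hence given by a matrix;
    T kills its range because vectors fixed by y^2 keep their norm under y. *)
Lemma one_sub_limit : exists E : 'M[LG]_m,
  T *m E = 0 /\ forall v, converges (@dotv R G m) (fun n => iter n.*2 (mact y) v) (mact E v).
Proof.
have [f hf] := choice (even_powers_converge (vip m) (@dotv_complete R G m)
  one_sub_sym one_sub_contr1).
have itB n u v : iter n (mact y) (u - v) = iter n (mact y) u - iter n (mact y) v.
  by rewrite -!mact_mxpow mactB.
have bnd v : dotv (f v) (f v) <= 2 * dotv v v.
  apply/ler_addgt0Pl => e e0; have e2 : 0 < e / 2 by lra.
  have [N /(_ _ (leqnn _))] := hf v _ e2; rewrite (dist2C (vip m)) => hN.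
  have := ip_sqD_le (vip m) (f v - iter N.*2 (mact y) v) (iter N.*2 (mact y) v).
  rewrite subrK => h1.
  have := iter_contr one_sub_contr1 N.*2 v; move: hN h1; rewrite /dist2; lra.
have [E hE] : exists E : 'M[LG]_m, forall v, mact E v = f v.
  apply: (@operator_matrix _ _ _ _ f 2) => // [a u v|g v].
  - apply: (converges_unique (vip m) (hf _)).
    have -> : (fun n => iter n.*2 (mact y) (a *: u + v)) =
        (fun n => a *: iter n.*2 (mact y) u + iter n.*2 (mact y) v).
      by apply/funext => n; rewrite -!mact_mxpow mactD mactZ.
    apply: (convergesD (vip m)) => //.
    apply: (@converges_map _ _ _ (@dotv R G m) _ (fun w => a *: w) (normc a ^+ 2)) => //.
    + by move=> w z; rewrite scalerBr.
    + by move=> w; rewrite dotv_scale.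
    + exact: (ip_ge0 (vip m)).
  - apply: (converges_unique (vip m) (hf _)).
    have -> : (fun n => iter n.*2 (mact y) (rregv g v)) =
        (fun n => rregv g (iter n.*2 (mact y) v)).
      by apply/funext => n; rewrite -!mact_mxpow mact_rregv.
    apply: (@converges_map _ _ _ (@dotv R G m) _ (rregv g) 1) => //.
    + exact: rregvB.
    + by move=> w; rewrite dotv_rregv mul1r.
    + exact: (ip_ge0 (vip m)).
exists E; split; last by move=> v; rewrite hE.
apply: mact_inj => v; rewrite mact0 mact_mulmx hE.
apply: (ip_eq0 (vip k)); apply/eqP; rewrite eq_le (ip_ge0 (vip k)) andbT.
(* Applying y^2 shifts the sequence of even powers by one, which does not change its limit. *)
have fix2 : mact y (mact y (f v)) = f v.
  apply: (converges_unique (vip m) _ (converges_comp (h := S) leqnSn (hf v))).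
  have -> : (fun n => iter n.*2 (mact y) v) \o S =
      (mact y \o mact y) \o (fun n => iter n.*2 (mact y) v) by [].
  apply: (@converges_map _ _ _ (@dotv R G m) _ _ 1) => //.
  + by move=> a b /=; rewrite !mactB.
  + by move=> a /=; rewrite mul1r; do 2 apply: le_trans (one_sub_contr1 _) _.
  + exact: (ip_ge0 (vip m)).
have := one_sub_contr (f v); have := one_sub_contr1 (mact y (f v)).
by rewrite fix2; lra.
Qed.

End OneMinusSquare.

(** Raising the power by one subtracts T' T y^n on one side and T T' Y^n on the other. These have
    equal traces, since T' Y^n = y^n T' and the trace is cyclic. *)
Lemma mtr_pow_one_sub k m (T : 'M[LG]_(k, m)) (T' : 'M[LG]_(m, k)) n :
  mtr (mxpow (1%:M - T' *m T) n) + k%:R = mtr (mxpow (1%:M - T *m T') n) + m%:R.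
Proof.
set y := 1%:M - T' *m T; set Y := 1%:M - T *m T'.
have yT p : T *m mxpow y p = mxpow Y p *m T.
  elim: p => [|p IH]; first by rewrite /mxpow /= mulmx1 mul1mx.
  rewrite /mxpow /= -/(mxpow y p) -/(mxpow Y p) -mulmxA -IH !mulmxA.
  by congr (_ *m _); rewrite /y /Y mulmxBr mulmxBl mulmx1 mul1mx mulmxA.
have yS p : mxpow y p.+1 = mxpow y p - T' *m (T *m mxpow y p).
  by rewrite /mxpow /= -/(mxpow y p) mulmxBl mul1mx mulmxA.
have YS p : mxpow Y p.+1 = mxpow Y p - T *m (T' *m mxpow Y p).
  by rewrite /mxpow /= -/(mxpow Y p) mulmxBl mul1mx mulmxA.
have YT p : T' *m mxpow Y p = mxpow y p *m T'.
  elim: p => [|p IH]; first by rewrite /mxpow /= mulmx1 mul1mx.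
  rewrite /mxpow /= -/(mxpow y p) -/(mxpow Y p) -mulmxA -IH !mulmxA.
  by congr (_ *m _); rewrite /y /Y mulmxBr mulmxBl mulmx1 mul1mx mulmxA.
have mtrB l (A B : 'M[LG]_l) : mtr (A - B) = mtr A - mtr B.
  by apply/eqP; rewrite eq_sym subr_eq -mtrD subrK.
elim: n => [|n IH]; first by rewrite /mxpow /= !mtr1 addrC.
rewrite yS YS !mtrB YT (mtr_mulC T' (T *m _)) -mulmxA.
by move: IH; lra.
Qed.

(* The even powers of [1 - T^* T] tend to the projection onto ker T, which is
   [1 - Q], while [1 - T T^*] has the same nontrivial spectrum and is the identity
   on the range of [D^*]. *)
Lemma trace_inequality_contr k m r (T : 'M[LG]_(k, m)) (D : 'M[LG]_(r, k))
    (Q : 'M[LG]_m) (M : R) :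
  (forall v, dotv (mact T v) (mact T v) <= dotv v v) ->
  D *m T = 0 -> T *m Q = T ->
  (forall i j, vn_adjoint (Q i j) (Q j i)) ->
  (forall W : 'M[LG]_m, T *m W = 0 -> Q *m W = 0) -> 0 < M ->
  (forall v, dotv (mact D v) (mact D v) <= M * dotv v v) ->
  \sum_j dotv (mact D (single j delta1)) (mact D (single j delta1)) <=
    M * (k%:R - mtr Q).
Proof.
move=> contrT DT TQ adjQ injT M0 boundD.
pose T' := starmx T; have contrT' := star_contraction contrT.
have adjT v w : dotv (mact T v) w = dotv v (mact T' w) by exact: dotv_star.
have adjT' v w : dotv (mact T' v) w = dotv v (mact T w).
  by rewrite (ipC (vip m)) -adjT (ipC (vip k)).
pose y := 1%:M - T' *m T; pose Y := 1%:M - T *m T'.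
have [E [TE limE]] := one_sub_limit adjT contrT'.
have QE := injT _ TE.
have yQ : y *m (1%:M - Q) = 1%:M - Q.
  by rewrite mulmxBl mul1mx -mulmxA mulmxBr mulmx1 TQ subrr mulmx0 subr0.
(* Both sides are determined by their pairings with vectors u - Q u: the range of E is killed by the
   symmetric Q, and 1 - Q is a symmetric idempotent. Powers of y fix u - Q u, so on these vectors
   the limit of <y^(2n) v, u - Q u> is <v, u - Q u>. *)
have Ev v : mact E v = v - mact Q v.
  apply/eqP; rewrite -subr_eq0; apply/eqP/(ip_eq0 (vip m)).
  set w := _ - _.
  have h u : dotv (mact E v) u = dotv (v - mact Q v) u.
    have -> : dotv (mact E v) u = dotv (mact E v) (u - mact Q u).
      rewrite (ipBr (vip m)) [X in _ - X](_ : _ = 0) ?subr0//.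
      by rewrite -(dotv_adjoint _ _ adjQ) -mact_mulmx QE mact0 (ip0l (vip m)).
    have -> : dotv (v - mact Q v) u = dotv v (u - mact Q u).
      by rewrite (ipBl (vip m)) (ipBr (vip m)) (dotv_adjoint _ _ adjQ).
    apply/eqP; rewrite -subr_eq0 -normr_eq0 eq_le normr_ge0 andbT.
    apply/ler_addgt0Pl => e e0; rewrite addr0.
    have [N /(_ _ (leqnn _))] := converges_ip (vip m) (u - mact Q u) e0 (limE v).
    rewrite (iter_sym (one_sub_sym adjT)).
    have -> : iter N.*2 (mact y) (u - mact Q u) = u - mact Q u.
      elim: N.*2 => //= n ->.
      by rewrite -{1}(mact1 u) -mact_subl -mact_mulmx yQ mact_subl mact1.
    by rewrite distrC.
  by rewrite (ipBl (vip m)) h subrr.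
pose s := \sum_j dotv (mact D (single j delta1)) (mact D (single j delta1)).
(* As Y is symmetric, the diagonal coefficients of Y^(2n) are the squares |Y^n e_j|^2, and D e_j = D
   Y^n e_j. *)
have low n : s <= M * mtr (mxpow Y n.*2).
  rewrite mtrE mulr_sumr; apply: ler_sum => j _.
  have DY p : D *m mxpow Y p = D.
    elim: p => [|p IH]; first by rewrite /mxpow /= mulmx1.
    by rewrite /mxpow /= -/(mxpow Y p) mulmxA mulmxBr mulmx1 mulmxA DT mul0mx subr0.
  rewrite mact_mxpow -addnn iterD (iter_sym (one_sub_sym adjT')) -mact_mxpow.
  by rewrite -{1 2}(DY n) mact_mulmx; exact: boundD.
rewrite -/s; apply/ler_addgt0Pl => e e0.
(* The m diagonal errors add up to at most e / M, also for m = 0. *)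
have em : 0 < e / M / m.+1%:R by rewrite !divr_gt0.
have [N hN] := choice (fun j : 'I_m =>
  converges_ip (vip m) (single j delta1) em (limE (single j delta1))).
pose n := (\max_j N j)%N.
have up : mtr (mxpow y n.*2) <= m%:R - mtr Q + e / M.
  have trQ : m%:R - mtr Q =
      \sum_j dotv (mact E (single j delta1)) (single j delta1).
    rewrite -(mtr1 R G m) !mtrE -sumrB; apply: eq_bigr => j _.
    by rewrite Ev (ipBl (vip m)) mact1.
  apply: (@le_trans _ _ (m%:R - mtr Q + \sum_(j < m) e / M / m.+1%:R)).
    rewrite trQ mtrE -big_split; apply: ler_sum => j _; rewrite mact_mxpow /=.
    have := hN j n (leq_bigmax j); by rewrite ler_norml => /andP[_]; rewrite lerBlDl.
  rewrite lerD2l sumr_const card_ord -[leLHS]mulr_natr mulrAC ler_pdivrMr//.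
  by rewrite ler_pM2l ?divr_gt0// ler_nat leqnSn.
have := mtr_pow_one_sub T T' n.*2; rewrite -/y -/Y => trE.
apply: le_trans (low n) _.
have -> : e + M * (k%:R - mtr Q) = M * (k%:R - mtr Q + e / M).
  by rewrite [RHS]mulrDr (mulrC M (e / M)) divfK ?gt_eqF// addrC.
by rewrite ler_pM2l//; lra.
Qed.

Lemma trace_inequality k m r (A : 'M[LG]_(k, m)) (D : 'M[LG]_(r, k))
    (Q : 'M[LG]_m) (M : R) :
  D *m A = 0 -> vn_projection Q ->
  (forall v : 'cV[LG]_m, A *m (Q *m v) = 0 -> Q *m v = 0) -> 0 < M ->
  (forall v, dotv (mact D v) (mact D v) <= M * dotv v v) ->
  \sum_j dotv (mact D (single j delta1)) (mact D (single j delta1)) <=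
    M * (k%:R - mtr Q).
Proof.
move=> DA [adjQ QQ] injA M0 boundD.
have [C C0 hC] := mact_bounded (A *m Q).
(* This factor makes c A Q a contraction; C + 1 is positive even for C = 0. *)
pose c := (Num.sqrt (C + 1))^-1.
have C1 : 0 < C + 1 by lra.
have c0 : 0 < c by rewrite invr_gt0 sqrtr_gt0.
have cC : c ^+ 2 * C <= 1.
  by rewrite exprVn sqr_sqrtr ?(ltW C1)// mulrC ler_pdivrMr// mul1r; lra.
have cZ v : dotv (c%:C *: mact (A *m Q) v) (c%:C *: mact (A *m Q) v) <= 1 * dotv v v.
  rewrite (ipZl (vip k)) (ipZr (vip k)) mulrA -expr2.
  apply: le_trans (ler_wpM2l (sqr_ge0 c) (hC v)) _; rewrite mulrA.
  by apply: ler_wpM2r => //; exact: (ip_ge0 (vip m)).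
have [|//||g v|T hT] := @operator_matrix R G k m (fun v => c%:C *: mact (A *m Q) v) 1.
- by move=> a u v; rewrite mactD mactZ scalerDr !scalerA mulrC.
- exact: cZ.
- rewrite mact_rregv; apply/funext => i; exact/val_inj/funext.
apply: (@trace_inequality_contr _ _ _ T) => //.
- by move=> v; rewrite hT -[leRHS]mul1r.
- apply: mact_inj => v.
  by rewrite mact_mulmx hT mactZ -mact_mulmx mulmxA DA mul0mx mact0 scaler0.
- by apply: mact_inj => v; rewrite mact_mulmx !hT -mact_mulmx -mulmxA QQ.
- move=> W TW.
  have AQW : A *m (Q *m W) = 0.
    apply: mact_inj => v; apply: (scalerI (_ : c%:C != 0)).
      by rewrite eq_complex /= eqxx andbT gt_eqF.
    by rewrite mulmxA mact_mulmx -hT -mact_mulmx TW !mact0 scaler0.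
  (* Injectivity on column vectors is applied to each column of W. *)
  apply/matrixP => i j; have := injA (W *m delta_mx j 0).
  rewrite !mulmxA -(mulmxA A) AQW mul0mx -colE => /(_ erefl)/matrixP/(_ i 0).
  by rewrite !mxE.
Qed.

End TraceInequality.

(** * The left regular representation *)

Section LeftRegular.
Context (R : realType) (G : groupType).
Local Notation LG := (vn R G).

Lemma lambda1 : lambda R (1%g : G) = 1.
Proof.
apply/val_inj/funext => x; apply/val_inj/funext => g /=.
by rewrite invg1 mul1g.
Qed.

Lemma lambdaM (g h : G) : lambda R (g * h)%g = lambda R g * lambda R h.
Proof.
by apply/val_inj/funext => x; apply/val_inj/funext => a /=; rewrite invgM mulgA.
Qed.

Lemma cocycle_1 (c : G -> LG) :
  (forall g h, c (g * h)%g = lambda R g * c h + c g) -> c 1%g = 0.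
Proof.
by move=> /(_ 1%g 1%g); rewrite mulg1 lambda1 mul1r -[LHS]add0r => /addIr/esym.
Qed.

End LeftRegular.

(** * Fox derivatives of a word *)

Section FoxDerivative.
Context (R : realType) (G : groupType) (k : nat) (s : 'I_k -> G) (w : word k).
Local Notation H := (ell2 R G).
Local Notation LG := (vn R G).
Local Notation dip := (@dot_ip R G).
Local Notation delta1 := (delta R (1%g : G)).
Local Notation letter p := (tnth (in_tuple w) p).

Definition prefix_eval n : G := word_eval s (take n w).

Lemma prefix_evalS (p : 'I_(size w)) :
  prefix_eval p.+1 = (prefix_eval p * letter_eval s (letter p))%g.
Proof.
rewrite /prefix_eval (take_nth (letter p)) ?ltn_ord// -cats1 /word_eval big_cat big_seq1.
by rewrite [in RHS](tnth_nth (letter p)).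
Qed.

(** The Fox derivative of x^-1 is -x^-1, so the term of an inverse letter sits at the prefix that
    includes this letter. *)
Definition fox_point (p : 'I_(size w)) : G :=
  if (letter p).2 then prefix_eval p else prefix_eval p.+1.

Definition fox_term (p : 'I_(size w)) : LG :=
  if (letter p).2 then lambda R (fox_point p) else - lambda R (fox_point p).

Definition fox_row : 'rV[LG]_k :=
  \row_j \sum_(p < size w | (letter p).1 == j) fox_term p.

Lemma fox_rowE (c : 'I_k -> LG) :
  \sum_j fox_row 0 j * c j = \sum_(p < size w) fox_term p * c (letter p).1.
Proof.
under eq_bigr do rewrite mxE mulr_suml big_mkcond.
rewrite exchange_big; apply: eq_bigr => p _ /=.
rewrite (bigD1 (letter p).1)//= eqxx big1 ?addr0// => j.
by rewrite eq_sym => /negPf ->.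
Qed.

Lemma fox_term_norm p (x : H) : dot (fox_term p x) (fox_term p x) = dot x x.
Proof.
rewrite /fox_term; case: ifP => _; first exact: dot_lreg.
rewrite [(- _ : LG) x](_ : _ = - lambda R (fox_point p) x)//.
by rewrite (ipNl dip) (ipNr dip) opprK; exact: dot_lreg.
Qed.

Lemma fox_row_bounded (v : 'I_k -> H) :
  dotv (mact fox_row v) (mact fox_row v) <= (size w)%:R ^+ 2 * dotv v v.
Proof.
rewrite {1}/dotv big_ord1.
have -> : mact fox_row v ord0 = \sum_(p < size w) fox_term p (v (letter p).1).
  rewrite /mact; under eq_bigr do rewrite mxE sum_vnE big_mkcond.
  rewrite exchange_big; apply: eq_bigr => p _ /=.
  rewrite (bigD1 (letter p).1)//= eqxx big1 ?addr0// => j.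
  by rewrite eq_sym => /negPf ->.
apply: le_trans (ip_sum_sqr_le dip _) _; rewrite expr2 -mulrA ler_wpM2l//.
apply: (@le_trans _ _ (\sum_(p < size w) dotv v v)).
  by apply: ler_sum => p _; rewrite fox_term_norm dot_le_dotv.
by rewrite sumr_const card_ord mulr_natl.
Qed.

(** Terms of the same generator sit at distinct group elements, hence send delta_1 to orthogonal
    unit vectors; each letter of w contributes 1. *)
Lemma fox_row_norm : injective (fun p => ((letter p).1, fox_point p)) ->
  \sum_j dotv (mact fox_row (single j delta1)) (mact fox_row (single j delta1)) =
  (size w)%:R.
Proof.
move=> inj.
have orth p q : (letter p).1 = (letter q).1 -> p != q ->
    dot (fox_term p delta1) (fox_term q delta1) = 0.
  move=> ij pq.
  have pt : fox_point p != fox_point q.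
    by apply: contra pq => /eqP pt; apply/eqP/inj; rewrite ij pt.
  have d0 : dot (lambda R (fox_point p) delta1) (lambda R (fox_point q) delta1) = 0.
    rewrite -[lambda R (fox_point q) delta1]/(lreg (fox_point q) delta1).
    rewrite -[lambda R (fox_point p) delta1]/(lreg (fox_point p) delta1).
    rewrite !lreg_delta !mulg1 dot_delta1 /=.
    by rewrite eq_sym (negPf pt).
  have N (a : LG) : (- a : LG) delta1 = - a delta1 by [].
  by rewrite /fox_term; case: ifP; case: ifP; rewrite ?N ?(ipNl dip) ?(ipNr dip) d0 ?oppr0.
transitivity (\sum_j \sum_(p < size w) ((letter p).1 == j)%:R : R).
  apply: eq_bigr => j _; rewrite /dotv big_ord1 mact_single mxE sum_vnE.
  rewrite (ip_suml dip) big_mkcond; apply: eq_bigr => p _.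
  case: eqP => //= pj; rewrite (ip_sumr dip) (bigD1 p)/=; last exact/eqP.
  rewrite fox_term_norm dot_delta1 /= eqxx big1 ?addr0// => q /andP[/eqP qj qp].
  by apply: orth; rewrite ?pj ?qj// eq_sym.
rewrite exchange_big /= -[in RHS](card_ord (size w)) -sumr_const.
apply: eq_bigr => p _; rewrite (bigD1 (letter p).1)//= eqxx big1 ?addr0// => j.
by rewrite eq_sym => /negPf ->.
Qed.

(** The fundamental formula of Fox calculus: the term of the p-th letter is the increment of c
    between consecutive prefixes, and the sum telescopes. For a relation the result is c(1) = 0; for
    general words it shows that the generators determine c. *)
Lemma fox_cocycle (c : G -> LG) :
  (forall g h, c (g * h)%g = lambda R g * c h + c g) ->
  \sum_j fox_row 0 j * c (s j) = c (word_eval s w).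
Proof.
move=> cM.
have c1 := cocycle_1 cM.
have cV g : c g^-1%g = - (lambda R g^-1%g * c g).
  by apply/eqP; rewrite -addr_eq0 addrC -cM mulVg c1.
rewrite (fox_rowE (fun j => c (s j))).
transitivity (\sum_(0 <= p < size w) (c (prefix_eval p.+1) - c (prefix_eval p))).
  rewrite big_mkord; apply: eq_bigr => p _.
  rewrite prefix_evalS /fox_term /fox_point cM addrK /letter_eval.
  case: ifP => lp; first by rewrite lp.
  rewrite prefix_evalS /letter_eval lp cV.
  by rewrite mulrN mulNr mulrA -lambdaM.
rewrite telescope_sumr// /prefix_eval take_size take0 [X in _ - X](_ : _ = 0) ?subr0//.
by rewrite /word_eval big_nil.
Qed.

End FoxDerivative.

(** * Fox terms of a shortest relation *)

Section ShortestRelation.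
Context (G : groupType) (k : nat) (s : 'I_k -> G) (w : word k).
Hypothesis w_red : reduced w.
Hypothesis w_min : forall w' : word k, w' != [::] -> reduced w' ->
  word_eval s w' = 1%g -> (size w <= size w')%N.

(** The subword between positions a and b is a nonempty reduced relation, so minimality applies to
    it. *)
Lemma prefix_eval_inj a b : (a < b <= size w)%N ->
  prefix_eval s w a = prefix_eval s w b -> (size w <= b - a)%N.
Proof.
move=> /andP[ab bw] eq_ab; pose u := drop a (take b w).
have su : size u = (b - a)%N by rewrite size_drop size_takel.
rewrite -su; apply: w_min.
- by rewrite -size_eq0 su subn_eq0 -ltnNge.
- by apply: drop_sorted; exact: take_sorted.
- apply: (mulgI (prefix_eval s w a)); rewrite mulg1 [RHS]eq_ab.
  rewrite /prefix_eval /word_eval -big_cat /=; congr bigop.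
  by rewrite -[in RHS](cat_take_drop a (take b w)) take_takel// ltnW.
Qed.

Lemma fox_point_inj :
  injective (fun p => ((tnth (in_tuple w) p).1, fox_point s p)).
Proof.
suff main (p q : 'I_(size w)) : (p < q)%N ->
    (tnth (in_tuple w) p).1 = (tnth (in_tuple w) q).1 ->
    fox_point s p = fox_point s q -> False.
  move=> p q [ij pt]; case: (ltngtP p q) => [lt|lt|/ord_inj//].
    by case: (main p q lt ij pt).
  by case: (main q p lt (esym ij) (esym pt)).
move=> pq ij; rewrite /fox_point.
have qw := ltn_ord q.
have small a : (size w <= q - a)%N -> False.
  by move=> h; have := leq_trans qw (leq_trans h (leq_subr _ _)); rewrite ltnn.
(* Letters of opposite sign: either the subword strictly between them is a nonempty relation, which
   is too short, or they are adjacent and cancel, contradicting reducedness. *)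
have opp (b : bool) : (tnth (in_tuple w) p).2 = b -> (tnth (in_tuple w) q).2 = ~~ b ->
    prefix_eval s w p.+1 = prefix_eval s w q -> False.
  move=> pb qb; have [pq1|pq1 _] := ltnP p.+1 q.
    by move=> /prefix_eval_inj h; apply: (small p.+1); apply: h; rewrite pq1 ltnW.
  have {}pq1 : (p.+1 = q :> nat)%N by apply/eqP; rewrite eqn_leq pq.
  have := elimT (sortedP (tnth (in_tuple w) p)) w_red p; rewrite pq1 => /(_ qw).
  rewrite -(tnth_nth _ (in_tuple w) p) -(tnth_nth _ (in_tuple w) q).
  by rewrite pb ij -qb; case: (tnth _ q) => /= a b'; rewrite eqxx.
case pb: (tnth (in_tuple w) p).2; case qb: (tnth (in_tuple w) q).2 => eq_pq.
- by apply: (small p); apply: prefix_eval_inj eq_pq; rewrite pq ltnW.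
(* Here the prefix before p equals the prefix through q; multiplying by the common generator gives
   the prefixes required. *)
- apply: (opp true) => //; rewrite prefix_evalS eq_pq prefix_evalS.
  by rewrite /letter_eval pb qb ij mulgVK.
- by apply: (opp false).
- by apply: (small p); rewrite -subSS; apply: prefix_eval_inj eq_pq; rewrite ltnS pq qw.
Qed.

End ShortestRelation.

(** * Cocycles and coboundaries with values in LG *)

Section Cohomology.
Context (R : realType) (G : groupType).
Local Notation LG := (vn R G).
Local Notation H1G := (H1 R G).
Implicit Types (c : Z1 R G) (g h : G).

Lemma Z1_mul c g h : (c (g * h)%g : LG) = lambda R g * (c h : LG) + (c g : LG).
Proof.
have /asboolP /(_ g h) := Z1P c; rewrite /coboundary1 addrAC => /eqP.
by rewrite subr_eq0 => /eqP <-.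
Qed.

Lemma pi_H1_eq0 c : (\pi_H1G c == 0 :> H1G) = (c \in @B1 R G).
Proof.
by rewrite -[c in RHS]subr0 Quotient.idealrBE -[0 in LHS](raddf0 (\pi_H1G)).
Qed.

Lemma vn_mulrn_eq0 (T : LG) n : (0 < n)%N -> T *+ n = 0 -> T = 0.
Proof.
move=> n0 Tn; apply/val_inj/funext => x; apply/val_inj/funext => g.
have E m : (T *+ m) x g = T x g *+ m.
  by elim: m => [|m IH]; rewrite ?mulr0n// !mulrS -IH.
have /eqP : T x g *+ n = 0 by rewrite -E Tn.
by rewrite mulrn_eq0 gtn_eqF// => /eqP.
Qed.

(** Averaging without division: with S the sum of all c(h) and n the order of G, summing the cocycle
    identity over h gives S = g S + n c(g), so n c is the coboundary of -S. *)
Lemma Z1_finite_coboundary c : finite_set [set: G] -> exists2 n, (0 < n)%N &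
  (n%:R : LG^c) *: c \in @B1 R G.
Proof.
move=> /finite_seqP[s0 sE]; pose s := undup s0.
have ms g : g \in s.
  by rewrite mem_undup; have : [set: G] g by []; rewrite sE.
have us : uniq s := undup_uniq _.
exists (size s); first by have := ms 1%g; case: (s).
apply/asboolP; exists (- \sum_(h <- s) (c h : LG)); apply/funext => g.
rewrite /coboundary0 /lact mulrN mulr_sumr opprK.
transitivity ((c g : LG) * (size s)%:R); last by [].
rewrite addrC.
have -> : \sum_(h <- s) (c h : LG) = \sum_(h <- s) (c (g * h)%g : LG).
  rewrite -(big_map (fun h => (g * h)%g) xpredT (fun h => (c h : LG))).
  apply: perm_big; apply: uniq_perm => //.
    by rewrite map_inj_uniq//; exact: mulgI.
  by move=> h; rewrite ms -[h in RHS](mulVKg g) (map_f (fun h => (g * h)%g))// ms.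
under eq_bigr do rewrite Z1_mul.
rewrite big_split /= addrC addKr big_const_seq count_predT iter_addr_0.
by rewrite mulr_natr.
Qed.

(** Each vector T x is invariant under left translations, hence a constant function, and a
    square-summable constant on an infinite group is 0. Thus the coboundaries form a free module of
    rank one. *)
Lemma coboundary0_eq0 (T : LG) : infinite_set [set: G] ->
  (forall g, lambda R g * T - T = 0) -> T = 0.
Proof.
move=> Ginf inv; apply/val_inj/funext => x; apply/val_inj/funext => g.
have cst h : T x h = T x 1%g.
  have /eqP := inv h^-1%g; rewrite subr_eq0 => /eqP Th.
  have := congr1 (fun S : LG => S x 1%g) Th; rewrite /= invgK mulg1 => <-.
  by [].
rewrite -[LHS]/(T x g) cst; apply/eqP; apply: contrapT => /negP Tx0; apply: Ginf.
(* If the constant were nonzero, Bessel's inequality would bound the number of elements of G. *)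
suff : exists N, forall s : seq G, uniq s -> (size s <= N)%N.
  move=> [N hN]; apply: contrapT => inf.
  have [s us ss] : exists2 s : seq G, uniq s & size s = N.+1.
    have [A _ cA] := infinite_set_fset N.+1 inf.
    exists (take N.+1 (finmap.enum_fset A)); first by rewrite take_uniq// finmap.fset_uniq.
    by rewrite size_takel.
  by have := hN s us; rewrite ss ltnn.
pose a := normc (T x 1%g) ^+ 2.
have a0 : 0 < a.
  rewrite exprn_gt0// lt0r Defs.normc_ge0 andbT.
  by apply: contra Tx0 => /eqP/eq0_normc ->.
exists (Num.truncn (dot (T x) (T x) / a)).+1 => s us.
have := bessel (T x) us.
under eq_bigr do rewrite cst.
rewrite big_const_seq count_predT iter_addr_0 -mulr_natl -ler_pdivlMr// => h.
rewrite -(ler_nat R); apply: le_trans h _; apply: ltW.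
have := truncnS_gt (dot (T x) (T x) / a).
by [].
Qed.

End Cohomology.

(** * Lifting projective submodules of H^1 to cocycles *)

Section ProjectiveSubmodules.
Context (R : realType) (G : groupType) (n : nat).
Local Notation LG := (vn R G).
Local Notation H1G := (H1 R G).
Context (q : 'M[LG]_n) (phi : 'cV[LG]_n -> H1G).
Hypothesis q_idem : q *m q = q.
Hypothesis phiD : {in mxrange q &, {morph phi : v w / v + w}}.
Hypothesis phiZ : {in mxrange q, forall v (a : LG), phi (rscale v a) = (a : LG^c) *: phi v}.
Hypothesis phi_inj : {in mxrange q &, injective phi}.

Lemma rscaleE (v : 'cV[LG]_n) (a : LG) : rscale v a = v *m a%:M.
Proof. by apply/colP => i; rewrite !mxE big_ord1 !mxE mulr1n. Qed.

Lemma mem_mxrange (v : 'cV[LG]_n) : q *m v \in mxrange q.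
Proof. by rewrite inE; exists v. Qed.

Lemma phi0 : phi 0 = 0.
Proof.
have m0 : (0 : 'cV[LG]_n) \in mxrange q by rewrite -(mulmx0 _ q) mem_mxrange.
by have := phiZ m0 (0 : LG); rewrite rscaleE mul0mx => ->; exact: scale0r.
Qed.

(** Representatives are chosen only for the images of the columns of q and extended linearly, which
    makes the lift LG-linear; choosing one for every class would not. *)
Definition lift_col j : Z1 R G := repr (phi (col j q)).

Definition lift (v : 'cV[LG]_n) : Z1 R G := \sum_j (v j 0 : LG^c) *: lift_col j.

Lemma liftE v g : (lift v g : LG) = \sum_j (lift_col j g : LG) * v j 0.
Proof. by rewrite /lift; elim/big_rec2: _ => [|j a b _ <-]. Qed.

(** For u in the range of q, u = q u is the combination of the columns of q with coefficients u_j,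
    and [phi] is linear there. *)
Lemma phi_lift (v : 'cV[LG]_n) : phi (q *m v) = \pi_H1G (lift (q *m v)).
Proof.
set u := q *m v.
suff [_ E] : (\sum_j rscale (col j q) (u j 0)) \in mxrange q /\
    phi (\sum_j rscale (col j q) (u j 0)) = \pi_H1G (lift u).
  rewrite -E; congr phi; apply/colP => i; rewrite summxE /u -{1}q_idem -mulmxA !mxE.
  by apply: eq_bigr => j _; rewrite !mxE.
have colq j (a : LG) : rscale (col j q) a = q *m (delta_mx j 0 *m a%:M).
  by rewrite rscaleE colE mulmxA.
apply: (big_ind2 (fun x z => x \in mxrange q /\ phi x = \pi_H1G z)).
- by rewrite phi0 raddf0 -(mulmx0 _ q) mem_mxrange.
- move=> x z y t [mx xz] [my yt]; split; last by rewrite phiD// xz yt raddfD.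
  by move: mx my; rewrite !inE => -[x' _ <-] [y' _ <-]; exists (x' + y'); rewrite ?mulmxDr.
- move=> j _; split; first by rewrite colq mem_mxrange.
  rewrite phiZ; last by rewrite colE mem_mxrange.
  by rewrite -[phi _]reprK; exact: H1_scale_pi.
Qed.

(** The hypothesis makes the lift a coboundary, so its class vanishes and injectivity of [phi] gives
    q v = 0; what remains says that t is invariant. *)
Lemma lift_eq0 (v : 'cV[LG]_n) (t : LG) : infinite_set [set: G] ->
  (forall g, (lift (q *m v) g : LG) + (lambda R g * t - t) = 0) -> q *m v = 0 /\ t = 0.
Proof.
move=> Ginf vt0.
have v0 : q *m v = 0.
  apply: phi_inj; rewrite ?mem_mxrange//; first by rewrite -(mulmx0 _ q) mem_mxrange.
  rewrite phi0 phi_lift; apply/eqP; rewrite pi_H1_eq0; apply/asboolP.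
  exists (- t); apply/funext => g; have /eqP := vt0 g; rewrite addr_eq0 => /eqP ->.
  by rewrite /coboundary0 /lact mulrN -opprD.
split=> //; apply: coboundary0_eq0 Ginf _ => g.
rewrite -[RHS](vt0 g) v0 liftE big1 ?add0r// => j _.
by rewrite mxE mulr0.
Qed.

(** Every class in H^1 is torsion by averaging, whereas LG is torsion-free, so each column of q
    vanishes. *)
Lemma finite_projection_eq0 : finite_set [set: G] -> q = 0.
Proof.
move=> Gfin; apply/matrixP => i j.
have [m m0 mB] := Z1_finite_coboundary (lift_col j) Gfin.
have E : phi (rscale (q *m delta_mx j 0) m%:R) = phi 0.
  rewrite phiZ ?mem_mxrange// phi0 -colE -[phi _]reprK.
  rewrite [LHS](H1_scale_pi (m%:R : LG^c) (lift_col j)).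
  by apply/eqP; rewrite pi_H1_eq0.
have mr : rscale (q *m delta_mx j 0) m%:R \in mxrange q.
  by rewrite rscaleE -mulmxA mem_mxrange.
have m00 : (0 : 'cV[LG]_n) \in mxrange q by rewrite -(mulmx0 _ q) mem_mxrange.
have /colP /(_ i) := phi_inj mr m00 E; rewrite -colE.
rewrite !mxE mulr_natr => /(vn_mulrn_eq0 m0); exact.
Qed.

End ProjectiveSubmodules.

(** * Bounding the first l^2-Betti number by a relation *)

Section BettiBound.
Context (R : realType) (G : groupType).
Local Notation LG := (vn R G).

Lemma betti1_finite : finite_set [set: G] -> (l2_betti1 R G <= 0)%E.
Proof.
move=> Gfin; apply: ge_ereal_sup.
move=> _ [d [P [_ [n [q [[_ qq] [phi [phiD phiZ [_ inj _]]] ->]]]]] <-].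
rewrite lee_fin big1// => i _.
by rewrite (finite_projection_eq0 phiZ inj Gfin) mxE retrE retr0.
Qed.

Lemma vn_adjoint0 : vn_adjoint (0 : LG) (0 : LG).
Proof.
move=> x y; congr (_ +i* _); congr rsum; apply/funext => g.
  change (complex.Re (0 * conjc (y g)) = complex.Re (x g * conjc 0)).
  by rewrite conjc0 mul0r mulr0.
change (complex.Im (0 * conjc (y g)) = complex.Im (x g * conjc 0)).
by rewrite conjc0 mul0r mulr0.
Qed.

Lemma betti1_relation k (s : 'I_k -> G) (w : word k) :
  generates s -> infinite_set [set: G] -> w != [::] -> word_eval s w = 1%g ->
  injective (fun p => ((tnth (in_tuple w) p).1, fox_point s p)) ->
  (l2_betti1 R G <= (k%:R - 1 - (size w)%:R^-1)%:E)%E.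
Proof.
move=> gen Ginf w0 ws1 winj.
apply: ge_ereal_sup => _ [d [P [_ [n [q [[adjq qq] [phi [phiD phiZ [_ inj _]]] ->]]]]] <-].
rewrite lee_fin.
(* [C] records the lifted cocycles on the generators and [B] the coboundary of 1; [Q] adjoins a
   summand of rank one for the coboundaries. *)
pose C : 'M[LG]_(k, n) := \matrix_(i, j) (lift_col q phi j (s i) : LG).
pose B : 'M[LG]_(k, 1) := \col_i (lambda R (s i) - 1).
pose Q : 'M[LG]_(n + 1) := block_mx q 0 0 1%:M.
have bM (g h : G) : lambda R (g * h)%g - 1 = lambda R g * (lambda R h - 1) + (lambda R g - 1).
  by rewrite lambdaM mulrBr mulr1 addrA subrK.
have DA : fox_row R s w *m row_mx C B = 0.
  apply/rowP => j; rewrite mul_mx_row -[j]splitK; case: (fintype.split j) => i /=.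
    rewrite row_mxEl !mxE; under eq_bigr do rewrite [C _ _]mxE.
    by rewrite (fox_cocycle s w (Z1_mul (lift_col q phi i))) ws1 (cocycle_1 (Z1_mul _)).
  rewrite row_mxEr !mxE; under eq_bigr do rewrite [B _ _]mxE.
  by rewrite (fox_cocycle (c := fun g => lambda R g - 1) s w bM) ws1 lambda1 subrr.
have projQ : vn_projection Q.
  split=> [a b|]; last first.
    by rewrite mulmx_block !mul0mx !mulmx0 !addr0 add0r mulmx1 qq.
  rewrite -[a]splitK -[b]splitK; case: (fintype.split a) => a'; case: (fintype.split b) => b' /=.
  - by rewrite !block_mxEul.
  - by rewrite block_mxEur block_mxEdl !mxE; exact: vn_adjoint0.
  - by rewrite block_mxEur block_mxEdl !mxE; exact: vn_adjoint0.
  - by rewrite !block_mxEdr !ord1 mxE eqxx.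
have injA (v : 'cV[LG]_(n + 1)) : row_mx C B *m (Q *m v) = 0 -> Q *m v = 0.
  rewrite -(vsubmxK v) mul_block_col !mul0mx addr0 add0r mul1mx mul_row_col => Av0.
  set v1 := usubmx v; set v2 := dsubmx v.
  pose z g := (lift q phi (q *m v1) g : LG) + (lambda R g * v2 0 0 - v2 0 0).
  have zM g h : z (g * h)%g = lambda R g * z h + z g.
    rewrite /z.
    have -> : lambda R (g * h)%g * v2 0 0 - v2 0 0 =
        lambda R g * (lambda R h * v2 0 0 - v2 0 0) + (lambda R g * v2 0 0 - v2 0 0).
      by rewrite lambdaM mulrBr mulrA addrA subrK.
    by rewrite Z1_mul [in RHS]mulrDr addrACA.
  (* The cocycle z vanishes on the generators, hence on every word. *)
  have z0 g : z g = 0.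
    have [u <-] := gen g; rewrite -(fox_cocycle s u zM) big1// => i _.
    rewrite (_ : z (s i) = 0) ?mulr0//.
    have /colP /(_ i) := Av0; rewrite !mxE big_ord1 => h.
    rewrite -[RHS]h /z liftE [B _ _]mxE mulrBl mul1r; congr (_ + _).
    by apply: eq_bigr => j _; rewrite [C _ _]mxE.
  have [-> t0] := lift_eq0 qq phiD phiZ inj Ginf z0.
  rewrite -/v2 (_ : v2 = 0) ?col_mx0//.
  by apply/matrixP => i j; rewrite !ord1 [RHS]mxE.
have l0 : 0 < (size w)%:R :> R by rewrite ltr0n lt0n size_eq0.
have := trace_inequality DA projQ injA (exprn_gt0 2 l0) (fox_row_bounded s w (R := R)).
rewrite fox_row_norm//.
have -> : mtr Q = \sum_i complex.Re (vn_trace (q i i)) + 1.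
  rewrite /mtr big_split_ord big_ord1 /= block_mxEdr mxE eqxx retr1; congr (_ + _).
  by apply: eq_bigr => i _; rewrite block_mxEul.
(* With l = [size w], the trace inequality reads l <= l^2 (k - d' - 1); one factor l is divided
   out. *)
move: (\sum_i _) => d'; rewrite expr2 -mulrA -[leLHS]mulr1 ler_pM2l//.
by rewrite mulrC -ler_pdivrMr// mul1r; lra.
Qed.

End BettiBound.

(** * From the Betti number to the girth *)

Lemma inve_le_of_le_inv (R : realType) (b : \bar R) (a l : R) : 0 < l ->
  (b <= (a - l^-1)%:E)%E -> (1 / (a%:E - b) <= l%:E)%E.
Proof.
move=> l0; case: b => [b| |]; last first.
- by move=> _; rewrite (_ : (a%:E - -oo = +oo)%E)// invey mule0 lee_fin ltW.
- by rewrite leye_eq.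
rewrite lee_fin => bl; have iv0 : 0 < l^-1 by rewrite invr_gt0.
have ab : l^-1 <= a - b by lra.
have ab0 : 0 < a - b := lt_le_trans iv0 ab.
rewrite -EFinB inver gt_eqF// mul1e lee_fin.
by rewrite -[leRHS]invrK lef_pV2.
Qed.

Local Open Scope ereal_scope.

(* The inverse on [\bar R] satisfies 0^-1 = +oo, which is the convention for
   the case where the first l^2-Betti number equals k - 1.  The hypothesis on
   k = 1 excludes the finite cyclic groups, for which the first l^2-Betti number
   is 0 = k - 1 but the girth is the (finite) order of the group. *)
Theorem theorem5p1 (R : realType) (G : groupType) (k : nat) (s : 'I_k -> G)
    (s_gen : generates s)
    (G_inf : k = 1%N -> infinite_set [set: G]) :
  1 / ((k%:R - 1)%:E - l2_betti1 R G) <= girth R s.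
Proof.
apply: le_ereal_inf_tmp => _ [w0 [w0n w0r w01] <-].
(* It suffices to bound the length of a shortest relation w. *)
have ex : exists n, `[< exists w : word k,
    [/\ w != [::], reduced w, word_eval s w = 1%g & size w = n] >].
  by exists (size w0); apply/asboolP; exists w0.
have [n /asboolP[w [wn wr w1 <-]] nmin] := ex_minnP ex.
have w_min (u : word k) : u != [::] -> reduced u -> word_eval s u = 1%g ->
    (size w <= size u)%N.
  by move=> un ur u1; apply: nmin; apply/asboolP; exists u.
apply: (@le_trans _ _ ((size w)%:R%R)%:E); last by rewrite lee_fin ler_nat w_min.
have sw : (0 < size w)%N by rewrite lt0n size_eq0.
apply: inve_le_of_le_inv; first by rewrite ltr0n.
have [Gfin|Ginf] := pselect (finite_set [set: G]); last first.
  exact: betti1_relation (fox_point_inj wr w_min).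
apply: le_trans (betti1_finite R Gfin) _; rewrite lee_fin.
(* For finite G the Betti number is at most 0, so 1 / [size w] <= k - 1 is what remains. The case k
   = 0 leaves no letter for the nonempty word w, and k = 1 is excluded by [G_inf]. *)
have k2 : (2 <= k)%N.
  case: (k) w wn {wr w1 nmin w_min sw} G_inf => [|[|k']]//.
    by case=> [|[[]]].
  by move=> _ _ /(_ erefl).
have : (2 <= k%:R :> R)%R by rewrite ler_nat.
have : ((size w)%:R^-1 <= 1 :> R)%R by rewrite invf_le1 ?ltr0n// ler1n.
by lra.
Qed.
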